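(* Let $k$ be an algebraically closed field of characteristic $p \ge 3$ and let $q(z) \in k[z]$ be a monic polynomial of odd degree without repeated roots. Let $X$ denote the hyperelliptic curve over $k$ (of genus $g\ge 2$) defined by the equation $y^2=q(x^p-x)$, and let $G$ denote the subgroup of $\mathrm{Aut}(X)$ generated by the automorphism $\tau$ given by $(x,y) \mapsto (x+1, y)$. Then the Hodge-de-Rham short exact sequence $$0 \rightarrow H^0(X, \Omega_X) \rightarrow H^1_{\mathrm{dR}}(X/k) \rightarrow H^1(X, \mathcal{O}_X) \rightarrow 0$$ does not split as a sequence of $k[G]$-modules.
   Context: Curves are smooth, projective and irreducible. A curve over $k$ is hyperelliptic if it admits a finite separable morphism of degree two to $\mathbb{P}^1_k$; hyperelliptic curves are assumed to have genus $g\ge 2$. The curve defined by $y^2=f(x)$, with $f\in k[x]$ monic without repeated roots, is the smooth projective curve with function field $k(x,y)$, where $y^2=f(x)$. The de-Rham cohomology $H^*_{\mathrm{dR}}(X/k)$ is the hypercohomology of the complex $\mathcal{O}_X \xrightarrow{d} \Omega_X$, where $\Omega_X$ is the sheaf of differentials on $X$ and $d$ is $f\mapsto df$. The Hodge-de-Rham short exact sequence is the part $0 \to H^0(X,\Omega_X)\to H^1_{\mathrm{dR}}(X/k)\to H^1(X,\mathcal{O}_X)\to 0$ (which is exact) of the long exact sequence relating $H^*_{\mathrm{dR}}(X/k)$ to the cohomology of $\mathcal{O}_X$ and $\Omega_X$. The group $G$ acts on all three terms by functoriality (pull-back), and the maps in the sequence are $k[G]$-linear. The sequence splits as a sequence of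 $k[G]$-modules if there is a $k[G]$-linear map $s\colon H^1(X,\mathcal{O}_X)\to H^1_{\mathrm{dR}}(X/k)$ whose composition with the projection $H^1_{\mathrm{dR}}(X/k)\to H^1(X,\mathcal{O}_X)$ is the identity. *)

(* Defs.v *)
From HB Require Import structures.
From mathcomp Require Import all_boot all_algebra.
From mathcomp Require Import ring_quotient generic_quotient.
From mathcomp Require Import boolp classical_sets functions cardinality.

Set Implicit Arguments.
Unset Strict Implicit.
Unset Printing Implicit Defensive.

Import GRing.Theory.
Local Open Scope classical_set_scope.
Local Open Scope ring_scope.
Local Open Scope quotient_scope.
#[local] Obligation Tactic := idtac.

Record submod (R : nzRingType) (V : lmodType R) := Submod {
  submod_mem :> V -> Prop;
  submod0 : submod_mem 0;
  submodP : forall a u v,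
    submod_mem u -> submod_mem v -> submod_mem (a *: u + v) }.

Section Submodules.
Context (R : nzRingType) (V : lmodType R) (Z : submod V).

Definition submod_pred : {pred V} := fun v => `[< Z v >].

Lemma submod_predP v : reflect (Z v) (v \in submod_pred).
Proof. exact: asboolP. Qed.

Fact submod_pred_closed : submod_closed submod_pred.
Proof.
split; first exact/submod_predP/submod0.
by move=> a u v /submod_predP Zu /submod_predP Zv; apply/submod_predP/submodP.
Qed.

HB.instance Definition _ :=
  GRing.isSubmodClosed.Build R V submod_pred submod_pred_closed.

Record sub := Sub_ { sub_val : V; sub_valP : sub_val \in submod_pred }.

HB.instance Definition _ := [isSub for sub_val].
HB.instance Definition _ := [Choice of sub by <:].
HB.instance Definition _ := [SubChoice_isSubLmodule of sub by <:].

Definition mksub v (Zv : Z v) : sub := Sub_ (introT (submod_predP v) Zv).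

Lemma sub_mem (w : sub) : Z (sub_val w).
Proof. exact/submod_predP/(sub_valP w). Qed.

Lemma sub_val_linear a (u v : sub) :
  sub_val (a *: u + v) = a *: sub_val u + sub_val v.
Proof. exact: (linearP (\val : {linear sub -> V})). Qed.

Definition quo := Quotient.quot submod_pred.
HB.instance Definition _ := GRing.Zmodule.on quo.
HB.instance Definition _ := EqQuotient.on quo.

Definition quo_pi (v : V) : quo := \pi_quo v.

Lemma quo_reprK (c : quo) : quo_pi (repr c) = c.
Proof. exact: reprK. Qed.

Lemma quo_eqP u v : (quo_pi u = quo_pi v) <-> Z (u - v).
Proof.
split=> [/eqP|h]; last apply/eqP.
  by rewrite -Quotient.idealrBE => /submod_predP.
by rewrite -Quotient.idealrBE; apply/submod_predP.
Qed.

Lemma quo_piD (u v : V) : quo_pi (u + v) = quo_pi u + quo_pi v.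
Proof. by rewrite /quo_pi !piE. Qed.

Definition quo_scale (a : R) (c : quo) : quo := quo_pi (a *: repr c).

Lemma quo_piZ a v : quo_pi (a *: v) = quo_scale a (quo_pi v).
Proof.
apply/quo_eqP; rewrite -scalerBr -[_ *: _]addr0; apply: submodP; last first.
  exact: submod0.
by apply/quo_eqP; rewrite quo_reprK.
Qed.

Fact quo_scaleA a b c : quo_scale a (quo_scale b c) = quo_scale (a * b) c.
Proof. by rewrite -[c]quo_reprK -!quo_piZ scalerA. Qed.

Fact quo_scale1 : left_id 1 quo_scale.
Proof. by move=> c; rewrite -[c]quo_reprK -quo_piZ scale1r. Qed.

Fact quo_scaleDr : right_distributive quo_scale +%R.
Proof.
move=> a c e; rewrite -[c]quo_reprK -[e]quo_reprK -quo_piD -!quo_piZ -quo_piD.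
by rewrite scalerDr.
Qed.

Fact quo_scaleDl c : {morph quo_scale^~ c : a b / a + b}.
Proof. by move=> a b; rewrite -[c]quo_reprK -!quo_piZ -quo_piD scalerDl. Qed.

HB.instance Definition _ := GRing.Zmodule_isLmodule.Build R quo
  quo_scaleA quo_scale1 quo_scaleDr quo_scaleDl.

Fact quo_pi_linear : linear quo_pi.
Proof. by move=> a u v; rewrite quo_piD quo_piZ. Qed.

HB.instance Definition _ :=
  GRing.isLinear.Build R V quo *:%R quo_pi quo_pi_linear.

End Submodules.

Section InducedMaps.
Context (R : nzRingType) (V V' : lmodType R) (Z : submod V) (Z' : submod V').
Context (phi : {linear V -> V'}) (phiZ : forall v, Z v -> Z' (phi v)).

Definition submap (w : sub Z) : sub Z' := mksub (phiZ (sub_mem w)).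

Fact submap_linear : linear submap.
Proof.
move=> a u v; apply: val_inj; rewrite [RHS]sub_val_linear.
by rewrite /= -linearP -sub_val_linear.
Qed.

HB.instance Definition _ :=
  GRing.isLinear.Build R (sub Z) (sub Z') *:%R submap submap_linear.

(* The proof argument is not used by the function itself: it is what makes
   [quomap _] canonically linear. *)
Definition quomap (_ : forall v, Z v -> Z' (phi v)) (c : quo Z) : quo Z' :=
  quo_pi Z' (phi (repr c)).

Lemma quomapE v : quomap phiZ (quo_pi Z v) = quo_pi Z' (phi v).
Proof.
apply/quo_eqP; rewrite -raddfB; apply/phiZ/quo_eqP.
by rewrite quo_reprK.
Qed.

Fact quomap_linear : linear (quomap phiZ).
Proof.
move=> a c e; rewrite -[c]quo_reprK -[e]quo_reprK.
by rewrite -linearP !quomapE !linearP.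
Qed.

HB.instance Definition _ :=
  GRing.isLinear.Build R (quo Z) (quo Z') *:%R (quomap phiZ)
    quomap_linear.

End InducedMaps.

Section Evaluation.
Context (R : nzRingType) (U V : lmodType R) (T : Type).

Lemma fst_lin a (z w : (U * V)%type) : (a *: z + w).1 = a *: z.1 + w.1.
Proof. by []. Qed.

Lemma snd_lin a (z w : (U * V)%type) : (a *: z + w).2 = a *: z.2 + w.2.
Proof. by []. Qed.

Lemma pair_lin a (u u' : U) (v v' : V) :
  (a *: u + u', a *: v + v') = a *: (u, v) + (u', v').
Proof. by []. Qed.

Lemma fct_lin a (f g : T -> U) t : (a *: f + g) t = a *: f t + g t.
Proof. by []. Qed.

End Evaluation.

Definition has_dim (k : fieldType) (V : lmodType k) (n : nat) : Prop :=
  exists b : 'I_n -> V,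
    bijective (fun c : {ffun 'I_n -> k} => \sum_i c i *: b i).

Record G_sequence (k : fieldType) (A : Type) := GSequence {
  left_mod : lmodType k;
  mid_mod : lmodType k;
  right_mod : lmodType k;
  seq_inc : {linear left_mod -> mid_mod};
  seq_proj : {linear mid_mod -> right_mod};
  left_act : A -> {linear left_mod -> left_mod};
  mid_act : A -> {linear mid_mod -> mid_mod};
  right_act : A -> {linear right_mod -> right_mod};
  seq_incP : forall a v, seq_inc (left_act a v) = mid_act a (seq_inc v);
  seq_projP : forall a v, seq_proj (mid_act a v) = right_act a (seq_proj v) }.

(* Splitting as a sequence of k[G]-modules, where G is a subset of A. *)
Definition splits (k : fieldType) (A : Type) (E : G_sequence k A)
    (G : A -> Prop) : Prop :=
  exists s : {linear right_mod E -> mid_mod E},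
    (forall a, G a -> forall c, s (right_act E a c) = mid_act E a (s c)) /\
    (forall c, seq_proj E (s c) = c).

Definition rs (R S : nzRingType) (phi : {rmorphism R -> S}) (V : lmodType S)
  : Type := V.

Section Restriction.
Context (R S : nzRingType) (phi : {rmorphism R -> S}) (V : lmodType S).

HB.instance Definition _ := GRing.Zmodule.copy (rs phi V) V.

Definition rs_scale (a : R) (v : rs phi V) : rs phi V := phi a *: (v : V).

Fact rs_scaleA a b v : rs_scale a (rs_scale b v) = rs_scale (a * b) v.
Proof. by rewrite /rs_scale scalerA rmorphM. Qed.
Fact rs_scale1 : left_id 1 rs_scale.
Proof. by move=> v; rewrite /rs_scale rmorph1 scale1r. Qed.
Fact rs_scaleDr : right_distributive rs_scale +%R.
Proof. by move=> a u v; rewrite /rs_scale scalerDr. Qed.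
Fact rs_scaleDl v : {morph rs_scale^~ v : a b / a + b}.
Proof. by move=> a b; rewrite /rs_scale rmorphD scalerDl. Qed.

HB.instance Definition _ := GRing.Zmodule_isLmodule.Build R (rs phi V)
  rs_scaleA rs_scale1 rs_scaleDr rs_scaleDl.

End Restriction.

Section FunctionField.
Context (k K : fieldType) (iota : {rmorphism k -> K}).

Definition derivation (M : lmodType K) (D : K -> M) : Prop :=
  [/\ forall a b, D (a + b) = D a + D b,
      forall a b, D (a * b) = a *: D b + b *: D a
    & forall c, D (iota c) = 0].

(* The module of Kaehler differentials of K/k, given by its universal
   property. *)
Record kaehler := Kaehler {
  Om :> lmodType K;
  diff : K -> Om;
  diffP : derivation diff;
  kaehler_ex : forall (M : lmodType K) (D : K -> M), derivation D ->
    exists phi : {linear Om -> M}, forall f, phi (diff f) = D f;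
  kaehler_uniq : forall (M : lmodType K) (phi psi : {linear Om -> M}),
    (forall f, phi (diff f) = psi (diff f)) -> phi =1 psi }.

(* The closed points of the smooth projective curve X with function field K:
   the valuation rings of K/k other than K, each being the local ring of X at
   the corresponding point. *)
Record place := Place {
  pl_ring :> K -> Prop;
  pl_const : forall c, pl_ring (iota c);
  pl_sub : forall f g, pl_ring f -> pl_ring g -> pl_ring (f - g);
  pl_mul : forall f g, pl_ring f -> pl_ring g -> pl_ring (f * g);
  pl_val : forall f, pl_ring f \/ pl_ring f^-1;
  pl_proper : exists f, ~ pl_ring f }.

Lemma place_eq (P Q : place) : (forall f, P f <-> Q f) -> P = Q.
Proof.
case: P Q => [P p1 p2 p3 p4 p5] [Q q1 q2 q3 q4 q5] /= PQ.
have {}PQ : P = Q by apply/funext => f; apply/propext.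
by subst Q; congr Place; exact: Prop_irrelevance.
Qed.

Lemma pl0 (P : place) : P 0.
Proof. by rewrite -(rmorph0 iota); apply: pl_const. Qed.

Lemma pl1 (P : place) : P 1.
Proof. by rewrite -(rmorph1 iota); apply: pl_const. Qed.

Lemma pl_add (P : place) f g : P f -> P g -> P (f + g).
Proof.
move=> Pf Pg; rewrite -[g]opprK; apply: pl_sub => //.
by rewrite -sub0r; apply: pl_sub => //; apply: pl0.
Qed.

(* An automorphism s of X over k is represented by the pull-back of rational
   functions, f |-> f \o s. *)
Record kaut := Kaut {
  kaut_fun :> {rmorphism K -> K};
  kaut_inv : {rmorphism K -> K};
  kautK : cancel kaut_fun kaut_inv;
  kautVK : cancel kaut_inv kaut_fun;
  kaut_const : forall c, kaut_fun (iota c) = iota c }.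

Definition kaut_one : kaut :=
  @Kaut idfun idfun (fun=> erefl) (fun=> erefl) (fun=> erefl).

Program Definition kaut_comp (s t : kaut) : kaut :=
  @Kaut (s \o t) (kaut_inv t \o kaut_inv s) _ _ _.
Next Obligation. by move=> s t f /=; rewrite !kautK. Qed.
Next Obligation. by move=> s t f /=; rewrite !kautVK. Qed.
Next Obligation. by move=> s t c /=; rewrite !kaut_const. Qed.

Program Definition kaut_inverse (s : kaut) : kaut :=
  @Kaut (kaut_inv s) s (@kautVK s) (@kautK s) _.
Next Obligation. by move=> s c; rewrite -{1}(kaut_const s) kautK. Qed.

Inductive generated_by (t : kaut) : kaut -> Prop :=
| gen_one : generated_by t kaut_one
| gen_gen : generated_by t t
| gen_comp s s' : generated_by t s -> generated_by t s' ->
    generated_by t (kaut_comp s s')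
| gen_inverse s : generated_by t s -> generated_by t (kaut_inverse s).

(* The image s(P): a rational function is regular at s(P) if and only if its
   pull-back is regular at P. *)
Program Definition push (s : kaut) (P : place) : place :=
  @Place (fun f => P (s f)) _ _ _ _ _.
Next Obligation. by move=> s P c; rewrite /= kaut_const; apply: pl_const. Qed.
Next Obligation. by move=> s P f g Pf Pg; rewrite /= rmorphB; apply: pl_sub. Qed.
Next Obligation. by move=> s P f g Pf Pg; rewrite /= rmorphM; apply: pl_mul. Qed.
Next Obligation. by move=> s P f; rewrite /= fmorphV; apply: pl_val. Qed.
Next Obligation.
move=> s P; have [f Pf] := pl_proper P.
by exists (kaut_inv s f); rewrite /= kautVK.
Qed.

Lemma push_inj s : injective (push s).
Proof.
move=> P Q PQ; apply: place_eq => f; rewrite -(kautVK s f).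
by have := congr1 (fun P : place => P (kaut_inv s f)) PQ => /= ->.
Qed.

(* A subsheaf of the constant sheaf V is given by its stalks at the closed
   points. The nonempty open subsets of X are the sets with finite complement;
   only those are used below. *)
Section Cochains.
Context (V : lmodType k) (F : place -> submod V).
Implicit Types (U : set place) (C : place -> set place).

Definition sections U (v : V) : Prop := forall P, U P -> F P v.

(* Open coverings of X indexed by its closed points. Such coverings are cofinal
   among all open coverings. *)
Definition is_cover C : Prop := forall P, C P P /\ finite_set (~` C P).

(* Cochains in the direct limit over all open coverings (in which Cech H^0 and
   H^1 are the sheaf cohomology). As X is irreducible, the restriction maps of F
   between nonempty open sets are inclusions inside V, and the direct limit is a
   union of submodules. *)
Definition cochain0 (g : place -> V) : Prop :=
  exists2 C, is_cover C & forall P, sections (C P) (g P).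

Definition cochain1 (f : place -> place -> V) : Prop :=
  exists2 C, is_cover C & forall P Q, sections (C P `&` C Q) (f P Q).

Definition cocycle1 (f : place -> place -> V) : Prop :=
  cochain1 f /\ forall P Q R, f P Q + f Q R = f P R.

Lemma is_coverI C D : is_cover C -> is_cover D ->
  is_cover (fun P => C P `&` D P).
Proof.
move=> hC hD P; have [CP fC] := hC P; have [DP fD] := hD P.
by split=> //; rewrite setCI finite_setU.
Qed.

Lemma is_coverT : is_cover (fun=> setT).
Proof. by move=> P; split=> //; rewrite setCT. Qed.

Fact global_closed a u v :
  sections setT u -> sections setT v -> sections setT (a *: u + v).
Proof. by move=> hu hv P PT; apply: submodP; [apply: hu|apply: hv]. Qed.

Definition global_sections : submod V :=
  @Submod _ _ (sections setT) (fun P _ => submod0 (F P)) global_closed.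

Lemma cochain0_0 : cochain0 0.
Proof. by exists (fun=> setT) => [|P Q _]; [apply: is_coverT|apply: submod0]. Qed.

Lemma cochain0P a g h : cochain0 g -> cochain0 h -> cochain0 (a *: g + h).
Proof.
move=> [C hC gC] [D hD hDh]; exists (fun P => C P `&` D P); first exact: is_coverI.
by move=> P Q [CQ DQ]; apply: submodP; [apply: gC|apply: hDh].
Qed.

Lemma cochain1_0 : cochain1 0.
Proof. by exists (fun=> setT) => [|P Q R _]; [apply: is_coverT|apply: submod0]. Qed.

Lemma cochain1P a f h : cochain1 f -> cochain1 h -> cochain1 (a *: f + h).
Proof.
move=> [C hC fC] [D hD hDh]; exists (fun P => C P `&` D P); first exact: is_coverI.
by move=> P Q R [[CP DP] [CQ DQ]]; apply: submodP; [apply: fC|apply: hDh].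
Qed.

Fact cocycle1_0 : cocycle1 0.
Proof. by split=> [|P Q R]; [exact: cochain1_0|exact: addr0]. Qed.

Fact cocycle1P a f h : cocycle1 f -> cocycle1 h -> cocycle1 (a *: f + h).
Proof.
move=> [Cf Zf] [Ch Zh]; split=> [|P Q R]; first exact: cochain1P.
rewrite -[LHS]/(a *: f P Q + h P Q + (a *: f Q R + h Q R)).
by rewrite -[RHS]/(a *: f P R + h P R) -(Zf P Q R) -(Zh P Q R) scalerDr addrACA.
Qed.

Definition Z1 : submod (place -> place -> V) := Submod cocycle1_0 cocycle1P.

Definition coboundary1 (z : sub Z1) : Prop :=
  exists2 g, cochain0 g & forall P Q, sub_val z P Q = g Q - g P.

Fact coboundary1_0 : coboundary1 0.
Proof. by exists 0 => [|P Q]; [exact: cochain0_0|rewrite subrr]. Qed.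

Fact coboundary1P a z w :
  coboundary1 z -> coboundary1 w -> coboundary1 (a *: z + w).
Proof.
move=> [g Cg zg] [h Ch wh]; exists (a *: g + h) => [|P Q]; first exact: cochain0P.
rewrite sub_val_linear.
rewrite -[LHS]/(a *: sub_val z P Q + sub_val w P Q) zg wh scalerBr addrACA.
by rewrite -opprD.
Qed.

Definition B1 : submod (sub Z1) := Submod coboundary1_0 coboundary1P.

Definition H0 : lmodType k := sub global_sections.
Definition H1 : lmodType k := quo B1.

End Cochains.

Section CochainPullBack.
Context (V : lmodType k) (F : place -> submod V) (s : kaut).
Context (phi : {linear V -> V}).
Hypothesis phiF : forall P v, F (push s P) v -> F P (phi v).

Definition pull0 (g : place -> V) : place -> V := fun P => phi (g (push s P)).

Definition pull1 (f : place -> place -> V) : place -> place -> V :=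
  fun P Q => phi (f (push s P) (push s Q)).

Fact pull0_linear : linear pull0.
Proof. by move=> a g h; apply/funext => P; apply: linearP. Qed.

Fact pull1_linear : linear pull1.
Proof.
by move=> a f h; apply/funext => P; apply/funext => Q; apply: linearP.
Qed.

HB.instance Definition _ :=
  GRing.isLinear.Build k (place -> V) (place -> V) *:%R pull0 pull0_linear.
HB.instance Definition _ :=
  GRing.isLinear.Build k (place -> place -> V) (place -> place -> V) *:%R
    pull1 pull1_linear.

Lemma is_cover_pull C :
  is_cover C -> is_cover (fun P => push s @^-1` C (push s P)).
Proof.
move=> hC P; have [CP fC] := hC (push s P); split=> //.
rewrite -[~` _]/(push s @^-1` (~` C (push s P))).
by apply: finite_preimage => // Q R _ _; exact: push_inj.
Qed.

Lemma global_pull v :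
  global_sections F v -> global_sections F (phi v).
Proof. by move=> hv P _; apply/phiF/hv. Qed.

Lemma cochain0_pull g : cochain0 F g -> cochain0 F (pull0 g).
Proof.
move=> [C hC gC]; exists (fun P => push s @^-1` C (push s P)).
  exact: is_cover_pull.
by move=> P Q CQ; apply/phiF/gC.
Qed.

Lemma cochain1_pull f : cochain1 F f -> cochain1 F (pull1 f).
Proof.
move=> [C hC fC]; exists (fun P => push s @^-1` C (push s P)).
  exact: is_cover_pull.
by move=> P Q R CR; apply/phiF/fC.
Qed.

Lemma cocycle1_pull f : Z1 F f -> Z1 F (pull1 f).
Proof.
move=> [Cf Zf]; split=> [|P Q R]; first exact: cochain1_pull.
by rewrite /pull1 -linearD Zf.
Qed.

Lemma coboundary1_pull z : B1 F z -> B1 F (submap cocycle1_pull z).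
Proof.
move=> [g Cg zg]; exists (pull0 g); first exact: cochain0_pull.
by move=> P Q; rewrite /= /pull1 zg linearB.
Qed.

Definition H0_pull : {linear H0 F -> H0 F} := submap global_pull.
Definition H1_pull : {linear H1 F -> H1 F} := quomap coboundary1_pull.

End CochainPullBack.

Definition rat_fun : lmodType k := rs iota K^o.

Fact pl_closed (P : place) (a : k) (f g : rat_fun) : P f -> P g -> P (a *: f + g).
Proof. by move=> Pf Pg; apply/pl_add/Pg/pl_mul/Pf/pl_const. Qed.

Definition O_X (P : place) : submod rat_fun := Submod (pl0 P) (@pl_closed P).

Fact kaut_linear (s : kaut) : linear (s : rat_fun -> rat_fun).
Proof.
move=> a f g; rewrite -[LHS]/(s (iota a * (f : K) + g)).
by rewrite rmorphD rmorphM kaut_const.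
Qed.

Definition fun_pull (s : kaut) : rat_fun -> rat_fun := s.
HB.instance Definition _ s :=
  GRing.isLinear.Build k rat_fun rat_fun *:%R (fun_pull s) (kaut_linear s).

Lemma fun_pullP s P f : O_X (push s P) f -> O_X P (fun_pull s f).
Proof. by []. Qed.

Section DeRham.
Context (Omega : kaehler).
Local Notation d := (diff Omega).

Definition rat_diff : lmodType k := rs iota Omega.

(* The stalk at P of the sheaf of differentials: the image of the Kaehler
   differentials of the local ring at P. *)
Definition regular_diff (P : place) (w : rat_diff) : Prop :=
  exists2 s : seq (K * K), (forall p, p \in s -> P p.1 /\ P p.2)
    & w = \sum_(p <- s) p.1 *: d p.2 :> Omega.

Fact regular_diff0 P : regular_diff P 0.
Proof. by exists [::] => //; rewrite big_nil. Qed.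

Fact regular_diff_closed P a v w :
  regular_diff P v -> regular_diff P w -> regular_diff P (a *: v + w).
Proof.
move=> [s Ps ->] [t Pt ->]; exists ([seq (iota a * p.1, p.2) | p <- s] ++ t).
  move=> p; rewrite mem_cat => /orP[/mapP[q qs ->]|/Pt //].
  by have [P1 P2] := Ps _ qs; split=> //=; apply/pl_mul/P1/pl_const.
rewrite big_cat big_map /=; congr (_ + _).
rewrite -[LHS]/(iota a *: (_ : Omega)) scaler_sumr.
by apply: eq_bigr => p _; rewrite scalerA.
Qed.

Definition Omega_X (P : place) : submod rat_diff :=
  Submod (regular_diff0 P) (@regular_diff_closed P).

Fact twisted_derivation (s : kaut) :
  derivation (fun f => d (s f) : rs s Omega).
Proof.
have [dD dM dc] := diffP Omega; split=> [a b|a b|c].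
- by rewrite rmorphD dD.
- by rewrite rmorphM dM.
- by rewrite kaut_const dc.
Qed.

Fact diff_pull_ex (s : kaut) : exists phi : {linear Omega -> rs s Omega},
  forall f, phi (d f) = d (s f).
Proof. exact: (kaehler_ex Omega (twisted_derivation s)). Qed.

(* The pull-back of differentials, f dg |-> (f \o s) d(g \o s). *)
Definition diff_pull (s : kaut) : rat_diff -> rat_diff :=
  projT1 (cid (diff_pull_ex s)).

Lemma diff_pullE s f g : diff_pull s (f *: d g) = s f *: d (s g) :> Omega.
Proof.
rewrite /diff_pull; case: cid => phi /= phid.
by rewrite linearZ phid.
Qed.

Lemma diff_pullD s v w : diff_pull s (v + w) = diff_pull s v + diff_pull s w.
Proof. exact: (linearD (projT1 (cid (diff_pull_ex s)))). Qed.

Fact diff_pull_linear s : linear (diff_pull s).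
Proof.
move=> a v w; rewrite diff_pullD; congr (_ + _).
rewrite /diff_pull; case: cid => phi /= _.
rewrite -[LHS]/(phi (iota a *: (v : Omega))) linearZ.
by rewrite -[LHS]/(s (iota a) *: (phi v : Omega)) kaut_const.
Qed.

HB.instance Definition _ s :=
  GRing.isLinear.Build k rat_diff rat_diff *:%R (diff_pull s)
    (diff_pull_linear s).

Lemma diff_pull_sum s (r : seq (K * K)) :
  diff_pull s (\sum_(p <- r) p.1 *: d p.2 : Omega) =
  \sum_(p <- r) s p.1 *: d (s p.2) :> Omega.
Proof.
elim: r => [|p r IH]; first by rewrite !big_nil; exact: (linear0 (diff_pull s)).
by rewrite !big_cons -IH -diff_pullE; exact: diff_pullD.
Qed.

Lemma diff_pullP s P w : Omega_X (push s P) w -> Omega_X P (diff_pull s w).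
Proof.
move=> [r Pr ->]; exists [seq (s p.1, s p.2) | p <- r]; last first.
  by rewrite big_map diff_pull_sum.
by move=> _ /mapP[q qr ->]; apply: Pr.
Qed.

Lemma diff0 : d 0 = 0.
Proof. by rewrite -(rmorph0 iota); have [_ _ ->] := diffP Omega. Qed.

Lemma diff_linear : linear (d : rat_fun -> rat_diff).
Proof.
have [dD dM dc] := diffP Omega => a f g.
rewrite -[LHS]/(d (iota a * (f : K) + g)) dD dM dc scaler0 addr0.
by [].
Qed.

Lemma diff_pull_diff s f : diff_pull s (d f) = d (s f) :> Omega.
Proof. by have := diff_pullE s 1 f; rewrite rmorph1 !scale1r. Qed.

(* H^1_dR(X/k) is the first hypercohomology of O_X -> Omega_X, computed by the
   total complex of the Cech double complex, in the limit over all coverings: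
   its 1-cochains are pairs (f, w), with f in C^1(O_X) and w in C^0(Omega_X);
   the coboundary of g in C^0(O_X) is (delta g, dg), and (f, w) is a cocycle if
   delta f = 0 and df = delta w. *)
Definition dR_cochain : lmodType k :=
  ((place -> place -> rat_fun) * (place -> rat_diff))%type.

Definition dR_cocycle (z : dR_cochain) : Prop :=
  [/\ cocycle1 O_X z.1, cochain0 Omega_X z.2
    & forall P Q, d (z.1 P Q) = z.2 Q - z.2 P :> Omega].

Fact dR_cocycle0 : dR_cocycle 0.
Proof.
split=> [||P Q]; [exact: cocycle1_0|exact: cochain0_0|].
by rewrite [RHS]subr0; exact: diff0.
Qed.

Fact dR_cocycleP a z w :
  dR_cocycle z -> dR_cocycle w -> dR_cocycle (a *: z + w).
Proof.
move=> [z1 z2 zd] [w1 w2 wd].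
have E1 : (a *: z + w).1 = a *: z.1 + w.1 := fst_lin a z w.
have E2 : (a *: z + w).2 = a *: z.2 + w.2 := snd_lin a z w.
split=> [||P Q]; rewrite ?E1 ?E2.
- exact: (@cocycle1P _ O_X).
- exact: (@cochain0P _ Omega_X).
by rewrite !fct_lin diff_linear zd wd scalerBr addrACA -opprD.
Qed.

Definition Z1_dR : submod dR_cochain := Submod dR_cocycle0 dR_cocycleP.

Definition dR_coboundary (z : sub Z1_dR) : Prop :=
  exists2 g, cochain0 O_X g &
    (forall P Q, (sub_val z).1 P Q = g Q - g P) /\
    (forall P, (sub_val z).2 P = d (g P)).

Fact dR_coboundary0 : dR_coboundary 0.
Proof.
exists 0; first exact: cochain0_0.
split=> [P Q|P]; first by rewrite subrr.
exact/esym/diff0.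
Qed.

Fact dR_coboundaryP a z w :
  dR_coboundary z -> dR_coboundary w -> dR_coboundary (a *: z + w).
Proof.
move=> [g Cg [z1 z2]] [h Ch [w1 w2]].
exists (a *: g + h); first exact: (@cochain0P _ O_X).
have E1 := fst_lin a (sub_val z) (sub_val w).
have E2 := snd_lin a (sub_val z) (sub_val w).
rewrite sub_val_linear; split=> [P Q|P].
  by rewrite E1 !fct_lin z1 w1 scalerBr addrACA -opprD.
by rewrite E2 !fct_lin z2 w2 diff_linear.
Qed.

Definition B1_dR : submod (sub Z1_dR) := Submod dR_coboundary0 dR_coboundaryP.

Definition H1_dR : lmodType k := quo B1_dR.

Definition dR_pull s (z : dR_cochain) : dR_cochain :=
  (pull1 s (fun_pull s) z.1, pull0 s (diff_pull s) z.2).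

Fact dR_pull_linear s : linear (dR_pull s).
Proof.
move=> a z w; rewrite /dR_pull -pair_lin.
have -> : (a *: z + w).1 = a *: z.1 + w.1 := fst_lin a z w.
have -> : (a *: z + w).2 = a *: z.2 + w.2 := snd_lin a z w.
by rewrite pull1_linear pull0_linear.
Qed.

HB.instance Definition _ s :=
  GRing.isLinear.Build k dR_cochain dR_cochain *:%R (dR_pull s)
    (dR_pull_linear s).

Lemma dR_cocycle_pull s z : Z1_dR z -> Z1_dR (dR_pull s z).
Proof.
move=> [z1 z2 zd]; split=> [||P Q].
- exact/(cocycle1_pull (@fun_pullP s)).
- exact/(cochain0_pull (@diff_pullP s)).
rewrite -[LHS]/(d (s (z.1 (push s P) (push s Q)))) -diff_pull_diff zd.
exact: (linearB (diff_pull s)).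
Qed.

Lemma dR_coboundary_pull s z :
  B1_dR z -> B1_dR (submap (@dR_cocycle_pull s) z).
Proof.
move=> [g Cg [z1 z2]]; exists (pull0 s (fun_pull s) g).
  exact/(cochain0_pull (@fun_pullP s)).
split=> [P Q|P].
  by rewrite -[LHS]/(fun_pull s ((sub_val z).1 _ _)) z1 linearB.
by rewrite -[LHS]/(diff_pull s ((sub_val z).2 _)) z2; apply: diff_pull_diff.
Qed.

Definition H1_dR_pull s : {linear H1_dR -> H1_dR} :=
  quomap (@dR_coboundary_pull s).

Definition HdR_proj_cochain (z : dR_cochain) : place -> place -> rat_fun := z.1.

Fact HdR_proj_cochain_linear : linear HdR_proj_cochain.
Proof. exact: fst_lin. Qed.

HB.instance Definition _ :=
  GRing.isLinear.Build k dR_cochain (place -> place -> rat_fun) *:%R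
    HdR_proj_cochain HdR_proj_cochain_linear.

Lemma HdR_proj_cocycle z : Z1_dR z -> Z1 O_X (HdR_proj_cochain z).
Proof. by case. Qed.

Lemma HdR_proj_coboundary z : B1_dR z -> B1 O_X (submap HdR_proj_cocycle z).
Proof. by move=> [g Cg [z1 _]]; exists g. Qed.

Definition HdR_proj : {linear H1_dR -> H1 O_X} := quomap HdR_proj_coboundary.

Definition HdR_inc_cochain (w : rat_diff) : dR_cochain := (0, fun=> w).

Fact HdR_inc_cochain_linear : linear HdR_inc_cochain.
Proof.
move=> a v w; rewrite /HdR_inc_cochain -pair_lin.
by rewrite scaler0 addr0.
Qed.

HB.instance Definition _ :=
  GRing.isLinear.Build k rat_diff dR_cochain *:%R
    HdR_inc_cochain HdR_inc_cochain_linear.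

Lemma HdR_inc_cocycle w :
  global_sections Omega_X w -> Z1_dR (HdR_inc_cochain w).
Proof.
move=> hw; split=> [||P Q]; first exact: cocycle1_0.
- by exists (fun=> setT) => [|P Q _]; [exact: is_coverT|exact: hw].
by rewrite [RHS]subrr; exact: diff0.
Qed.

Definition HdR_inc : {linear H0 Omega_X -> H1_dR} :=
  quo_pi B1_dR \o submap HdR_inc_cocycle.

Lemma HdR_inc_pull s w :
  HdR_inc (H0_pull (@diff_pullP s) w) = H1_dR_pull s (HdR_inc w).
Proof.
rewrite /HdR_inc /H1_dR_pull /= quomapE; congr (quo_pi _ _); apply: val_inj.
rewrite /= /dR_pull /HdR_inc_cochain /=; congr pair.
by apply/funext => P; apply/funext => Q; apply/esym/(linear0 (fun_pull s)).
Qed.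

Lemma HdR_proj_pull s c :
  HdR_proj (H1_dR_pull s c) = H1_pull (@fun_pullP s) (HdR_proj c).
Proof.
rewrite -[c]quo_reprK /HdR_proj /H1_dR_pull /H1_pull /= !quomapE.
by congr (quo_pi _ _); apply: val_inj.
Qed.

Definition Hodge_deRham : G_sequence k kaut :=
  GSequence HdR_inc_pull HdR_proj_pull.

End DeRham.

(* K = k(x,y), where x is transcendental over k and y^2 = f(x); when f is not a
   square in k[x], this determines K, x and y up to isomorphism. *)
Definition is_function_field (f : {poly k}) (x y : K) : Prop :=
  [/\ forall P : {poly k}, (map_poly iota P).[x] = 0 -> P = 0,
      y ^+ 2 = (map_poly iota f).[x]
    & forall S : {pred K}, divring_closed S ->
        (forall c, iota c \in S) -> x \in S -> y \in S -> forall z, z \in S].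

End FunctionField.

(* Main.v *)
Require Import Defs.
From mathcomp Require Import all_boot all_algebra.
From mathcomp Require Import ring zify.
From mathcomp Require Import boolp classical_sets cardinality.

(** Translating [x] by a root of [q (X^p - X)], write the equation as
    [y^2 = x F(x)] with [F(0) <> 0], of degree [2g + 1]; as [p] divides
    [2g + 1], [g] is nonzero in [k]. The class of [y / x^g] in [H^1(X, O_X)] is
    [tau]-invariant, since [theta := tau (y / x^g) - y / x^g] is regular at
    infinity. An equivariant splitting lifts it to an invariant class of
    [H^1_dR], that is, to a differential [w], regular at infinity, with
    [tau w - w = d theta]: the ambiguity is a function regular everywhere, hence
    constant. But [eta = y / x^(g+1)] is a local parameter at infinity,
    [tau] is the identity modulo [eta^2] on the local ring, so that
    [tau w - w] vanishes at infinity, whereas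
    [theta = - g eta + higher order terms], so [d theta] does not vanish. *)

Set Implicit Arguments.
Unset Strict Implicit.
Unset Printing Implicit Defensive.

Import GRing.Theory.
Local Open Scope classical_set_scope.
Local Open Scope ring_scope.

(** * Valuation rings avoiding a given function *)

Section IntermediateRings.
Context (k K : fieldType) (iota : {rmorphism k -> K}).
Implicit Types (R : set K) (f g v w z : K).

Definition intermediate_ring R : Prop :=
  [/\ forall c, R (iota c),
      forall f g, R f -> R g -> R (f - g)
    & forall f g, R f -> R g -> R (f * g)].

Lemma place_ring (P : place iota) : intermediate_ring P.
Proof. by split; [exact: pl_const|exact: pl_sub|exact: pl_mul]. Qed.

Section Closure.
Context (R : set K) (hR : intermediate_ring R).

Lemma ring_const c : R (iota c). Proof. by case: hR. Qed.

Lemma ringB f g : R f -> R g -> R (f - g). Proof. by case: hR => _ /(_ f g). Qed.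

Lemma ringM f g : R f -> R g -> R (f * g).
Proof. by case: hR => _ _ /(_ f g). Qed.

Lemma ring0 : R 0. Proof. by rewrite -(rmorph0 iota); exact: ring_const. Qed.

Lemma ring1 : R 1. Proof. by rewrite -(rmorph1 iota); exact: ring_const. Qed.

Lemma ringN f : R f -> R (- f).
Proof. by move=> Rf; rewrite -sub0r; apply: ringB => //; exact: ring0. Qed.

Lemma ringD f g : R f -> R g -> R (f + g).
Proof. by move=> Rf Rg; rewrite -[g]opprK; apply/ringB/ringN. Qed.

Lemma ringX f n : R f -> R (f ^+ n).
Proof.
move=> Rf; elim: n => [|n IH]; first exact: ring1.
by rewrite exprS; apply: ringM.
Qed.

Lemma ring_sum (I : Type) (r : seq I) (C : pred I) (F : I -> K) :
  (forall i, C i -> R (F i)) -> R (\sum_(i <- r | C i) F i).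
Proof. by move=> RF; apply: big_ind => //; [exact: ring0|exact: ringD]. Qed.

Lemma ring_horner (A : {poly K}) v : (forall i, R A`_i) -> R v -> R A.[v].
Proof.
move=> RA Rv; rewrite horner_coef; apply: ring_sum => i _.
by apply: ringM; [exact: RA|exact: ringX].
Qed.

Lemma ring_horner_map (A : {poly k}) v : R v -> R (map_poly iota A).[v].
Proof. by apply: ring_horner => i; rewrite coef_map; exact: ring_const. Qed.

Definition adjoin v : set K :=
  [set z | exists2 A : {poly K}, (forall i, R A`_i) & z = A.[v]].

Lemma adjoin_ring v : intermediate_ring (adjoin v).
Proof.
split=> [c|f g [A RA ->] [B RB ->]|f g [A RA ->] [B RB ->]].
- exists (iota c)%:P; last by rewrite hornerC.
  by move=> i; rewrite coefC; case: ifP => _; [exact: ring_const|exact: ring0].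
- exists (A - B); last by rewrite hornerD hornerN.
  by move=> i; rewrite coefB; apply: ringB.
- exists (A * B); last by rewrite hornerM.
  by move=> i; rewrite coefM; apply: ring_sum => j _; apply: ringM.
Qed.

Lemma sub_adjoin v : R `<=` adjoin v.
Proof.
move=> z Rz; exists z%:P; last by rewrite hornerC.
by move=> i; rewrite coefC; case: ifP => _ //; exact: ring0.
Qed.

Lemma adjoin_gen v : adjoin v v.
Proof.
exists 'X; last by rewrite hornerX.
by move=> i; rewrite coefX; case: eqP => _; [exact: ring1|exact: ring0].
Qed.

End Closure.

(* When every [1 - w r] with [r] in [R] is a unit, a relation of degree [m] for
   [v^-1] lowers the degree of a relation of degree [n >= m] for [v]. *)
Lemma no_opposite_relations R w : intermediate_ring R -> R w -> ~ R w^-1 ->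
    (forall r, R r -> R (1 - w * r)^-1) ->
  forall N n m v (A B : {poly K}), (n + m <= N)%N -> v != 0 ->
    (size A <= n.+1)%N -> (size B <= m.+1)%N ->
    (forall i, R A`_i) -> (forall i, R B`_i) ->
    w * A.[v] = 1 -> w * B.[v^-1] = 1 -> False.
Proof.
move=> hR Rw nRw uR; elim=> [|N IH] n m v A B nmN v0 sA sB RA RB.
  move=> EA _; move: nmN; rewrite leqn0 addn_eq0 => /andP[/eqP n0 _].
  move: sA; rewrite n0 => /size1_polyC EA0; apply: nRw.
  move: EA; rewrite EA0 hornerC => E; rewrite -[w^-1]mulr1 -E mulKf //.
  by apply/eqP => w0; move: E; rewrite w0 mul0r => /eqP; rewrite eq_sym oner_eq0.
wlog mn : n m v A B nmN v0 sA sB RA RB / (m <= n)%N => [H|].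
  case/orP: (leq_total m n) => mn EA EB; first exact: (H n m v A B).
  by apply: (H m n v^-1 B A); rewrite ?invr_eq0 ?invrK // addnC.
have w0 : w != 0.
  by apply/eqP => w0; apply: nRw; rewrite w0 invr0; exact: (ring0 hR).
case: n => [|n] in nmN sA mn *.
  have {mn} m0 : m = 0%N by apply/eqP; rewrite -leqn0.
  move=> EA _; apply: nRw; move: EA; rewrite (size1_polyC sA) hornerC => E.
  by rewrite -[w^-1]mulr1 -E mulKf.
move=> EA EB.
case: m => [|m] in nmN sB mn *.
  apply: nRw; move: EB; rewrite (size1_polyC sB) hornerC => E.
  by rewrite -[w^-1]mulr1 -E mulKf.
(* [B1] takes at [v] the value [v^(n+1) (B(v^-1) - B_0)], a polynomial of degree at most [n].
   Multiplied by [v^(n+1)], the relation for [v^-1] thus solves for [v^(n+1)], which then replaces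
   the top power in [A]. *)
pose B1 := \poly_(j < n.+1) B`_(n - j).+1.
have EB1 : B1.[v] = v ^+ n.+1 * (B.[v^-1] - B`_0).
  rewrite horner_poly (@horner_coef_wide _ n.+2 B); last exact: leq_trans sB _.
  rewrite [in RHS]big_ord_recl /= expr0 mulr1 [X in _ * (X - _)]addrC addrK mulr_sumr.
  rewrite [LHS](reindex_inj rev_ord_inj) /=; apply: eq_bigr => i _.
  have lin : (i <= n)%N by rewrite -ltnS.
  rewrite /bump /= add1n subSS subKn // exprVn mulrCA; congr (_ * _).
  apply: (mulIf (expf_neq0 i.+1 v0)); rewrite mulfVK ?expf_neq0 //.
  by rewrite -exprD addnS subnK.
pose u := (1 - w * B`_0)^-1.
have u0 : 1 - w * B`_0 != 0.
  apply/eqP => E; apply: nRw.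
  have -> : w^-1 = B`_0 by rewrite -[B`_0](mulKf w0) -(subr0_eq E) mulr1.
  exact: RB.
have Ru : R u by apply: uR; apply: RB.
have EXn : v ^+ n.+1 = w * u * B1.[v].
  rewrite EB1 /u.
  transitivity (v ^+ n.+1 * (w * B.[v^-1] - w * B`_0) / (1 - w * B`_0)).
    by rewrite EB; field.
  by field.
pose A1 := \poly_(i < n.+1) A`_i + (A`_n.+1 * w * u) *: B1.
apply: (IH n m.+1 v A1 B) => //.
- apply: leq_trans (size_polyD _ _) _; rewrite geq_max size_poly /=.
  exact: leq_trans (size_scale_leq _ _) (size_poly _ _).
- move=> i; rewrite coefD coefZ !coef_poly.
  have R0 := ring0 hR.
  apply: (ringD hR); first by case: ifP.
  by apply: (ringM hR); [do 2!apply: (ringM hR) => //|case: ifP].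
- rewrite -EA; congr (_ * _).
  rewrite (@horner_coef_wide _ n.+2 A) // big_ord_recr /= EXn hornerD hornerZ.
  by rewrite horner_poly !mulrA.
Qed.

(** If [v] and [v^-1] were both outside [R], maximality would put [w^-1] in both [R[v]] and
    [R[v^-1]]: two relations excluded by [no_opposite_relations]. The condition on units there
    follows from maximality too. *)
Lemma maximal_subring_valuation R w : intermediate_ring R -> R w -> ~ R w^-1 ->
    (forall R', intermediate_ring R' -> R `<=` R' -> ~ R' w^-1 -> R' `<=` R) ->
  forall f, R f \/ R f^-1.
Proof.
move=> hR Rw nRw maxR.
have w0 : w != 0.
  by apply/eqP => w0; apply: nRw; rewrite w0 invr0; exact: (ring0 hR).
have nz r : R r -> 1 - w * r != 0.
  move=> Rr; apply/eqP => E; apply: nRw.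
  by have -> : w^-1 = r by rewrite -[r](mulKf w0) -(subr0_eq E) mulr1.
have uR r : R r -> R (1 - w * r)^-1.
  move=> Rr.
  (* The localisation at the elements [1 - w b] still omits [w^-1]: from [w^-1 = a / (1 - w b)]
     would follow [w (a + b) = 1]. By maximality it is contained in [R]. *)
  pose R' z := exists2 a, R a & exists2 b, R b & z = a / (1 - w * b).
  apply: (maxR R'); last by exists 1; [exact: (ring1 hR)|exists r; rewrite ?div1r].
  - split=> [c|_ _ [a Ra [b Rb ->]] [c Rc [d Rd ->]]|].
    + exists (iota c); first exact: (ring_const hR).
      by exists 0; [exact: (ring0 hR)|rewrite mulr0 subr0 divr1].
    + have R1 := ring1 hR.
      exists (a * (1 - w * d) - c * (1 - w * b)).
        by do ?[apply: (ringB hR) => //|apply: (ringM hR) => //].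
      exists (b + d - w * b * d).
        by do ?[apply: (ringB hR) => //|apply: (ringM hR) => //|apply: (ringD hR) => //].
      have := nz _ Rb; have := nz _ Rd => nd nb.
      have -> : 1 - w * (b + d - w * b * d) = (1 - w * b) * (1 - w * d) by ring.
      by field; rewrite nb nd.
    + move=> _ _ [a Ra [b Rb ->]] [c Rc [d Rd ->]].
      exists (a * c); first exact: (ringM hR).
      exists (b + d - w * b * d).
        by do ?[apply: (ringB hR) => //|apply: (ringM hR) => //|apply: (ringD hR) => //].
      have := nz _ Rb; have := nz _ Rd => nd nb.
      have -> : 1 - w * (b + d - w * b * d) = (1 - w * b) * (1 - w * d) by ring.
      by field; rewrite nb nd.
  - move=> z Rz; exists z => //; exists 0; first exact: (ring0 hR).
    by rewrite mulr0 subr0 divr1.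
  - move=> [a Ra [b Rb E]]; have nb := nz _ Rb; apply: (negP (nz (a + b) _)).
      exact: (ringD hR).
    have -> : w * (a + b) = 1; last by rewrite subrr.
    have -> : a = w^-1 * (1 - w * b) by rewrite E divfK.
    by field.
move=> v; have [->|v0] := eqVneq v 0; first by left; exact: (ring0 hR).
have adj z : ~ R z -> exists2 A : {poly K}, (forall i, R A`_i) & w * A.[z] = 1.
  move=> nRz; apply: contrapT => H; apply: nRz.
  apply: (maxR (adjoin R z)); [exact: adjoin_ring|exact: sub_adjoin| |exact: adjoin_gen].
  by move=> [A RA E]; apply: H; exists A => //; rewrite -E mulfV.
apply: contrapT => /not_orP[/adj[A RA EA] /adj[B RB EB]].
apply: (@no_opposite_relations R w hR Rw nRw uR _ (size A) (size B) v A B) => //.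
Qed.

End IntermediateRings.

Section Chevalley.
Context (k : closedFieldType) (K : fieldType) (iota : {rmorphism k -> K}).
Implicit Types (R : set K) (f g v w z : K).

Lemma algebraic_is_const (A : {poly k}) z :
  A != 0 -> (map_poly iota A).[z] = 0 -> exists c, z = iota c.
Proof.
move=> A0; have [r ->] := closed_field_poly_normal A.
rewrite linearZ /= hornerZ => /eqP; rewrite mulf_eq0 fmorph_eq0 lead_coef_eq0.
rewrite (negPf A0) /=; elim: r => [|c r IH].
  by rewrite big_nil rmorph1 hornerC oner_eq0.
rewrite big_cons rmorphM hornerM mulf_eq0 => /orP[|/IH //].
rewrite rmorphB /= map_polyX map_polyC /= hornerD hornerN hornerX hornerC.
by rewrite subr_eq0 => /eqP ->; exists c.
Qed.

(** Zorn's lemma, starting from [k[z^-1]], gives a subring maximal among those that contain the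
    constants and [z^-1] but not [z]; it is a valuation ring. *)
Lemma place_avoiding z : (forall c, z <> iota c) -> exists P : place iota, ~ P z.
Proof.
move=> nz; pose w := z^-1.
have z0 : z != 0 by apply/eqP => z0; apply: (nz 0); rewrite rmorph0.
have w0 : w != 0 by rewrite invr_eq0.
pose good R := [/\ intermediate_ring iota R, R w & ~ R z].
pose R0 := [set f | exists A : {poly k}, f = (map_poly iota A).[w]].
have good0 : good R0.
  split; first split.
  - by move=> c; exists c%:P; rewrite map_polyC hornerC.
  - by move=> _ _ [A ->] [B ->]; exists (A - B); rewrite rmorphB hornerD hornerN.
  - by move=> _ _ [A ->] [B ->]; exists (A * B); rewrite rmorphM hornerM.
  - by exists 'X; rewrite map_polyX hornerX.
  move=> [A E].
  (* If [z = A(w)] with [w = z^-1], then [w] is a root of [X A - 1], hence constant. *)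
  have [||c wc] := @algebraic_is_const ('X * A - 1) w.
  - apply/eqP => /(congr1 (fun B : {poly k} => B.[0])).
    rewrite hornerD hornerM hornerX hornerN !hornerC mul0r sub0r => /eqP.
    by rewrite oppr_eq0 oner_eq0.
  - by rewrite rmorphB rmorphM rmorph1 /= map_polyX !hornerE -E mulVf // subrr.
  by apply: (nz c^-1); rewrite fmorphV -wc invrK.
pose Pg := [set R | R = set0 \/ good R].
have [F FP Ft|M [[M0|Mg] Mmax]] := @Zorn_bigcup K Pg.
- have [[R FR gR]|H] := pselect (exists2 R, F R & good R); last first.
    left; apply/seteqP; split=> // f [R FR Rf].
    by case: (FP R FR) => [E|gR]; [rewrite E in Rf|case: H; exists R].
  right; have gF S f : F S -> S f -> good S.
    by move=> FS Sf; case: (FP S FS) => // E; rewrite E in Sf.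
  have two f g : (\bigcup_(X in F) X) f -> (\bigcup_(X in F) X) g ->
      exists S, [/\ F S, good S, S f & S g].
    move=> [S FS Sf] [T FT Tg].
    case: (Ft S T FS FT) => h.
      by exists T; split=> //; [exact: (gF _ g)|exact: h].
    by exists S; split=> //; [exact: (gF _ f)|exact: h].
  split; first split.
  + by move=> c; exists R => //; case: gR => hR _ _; exact: (ring_const hR).
  + move=> f g hf hg; have [S [FS [hS _ _] Sf Sg]] := two f g hf hg.
    by exists S => //; exact: (ringB hS).
  + move=> f g hf hg; have [S [FS [hS _ _] Sf Sg]] := two f g hf hg.
    by exists S => //; exact: (ringM hS).
  + by exists R => //; case: gR.
  + by move=> [S FS Sz]; have [_ _] := gF _ _ FS Sz; apply.
- exfalso; apply: (Mmax R0); last by right.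
  rewrite M0; split=> //; move/(_ w); apply; by case: good0.
have [hM Mw nMz] := Mg.
have val : forall f, M f \/ M f^-1.
  apply: (@maximal_subring_valuation k K iota M w) => //; rewrite /w ?invrK //.
  move=> R' hR' MR' nR'; apply: contrapT => nsub; apply: (Mmax R') => //.
  by right; split=> //; exact: MR'.
have prop : exists f, ~ M f by exists z.
case: hM => h1 h2 h3.
by exists (Place h1 h2 h3 val prop).
Qed.

Lemma regular_everywhere_const z :
  (forall P : place iota, P z) -> exists c, z = iota c.
Proof.
move=> hz; apply: contrapT => nz.
have [c zc|P] := @place_avoiding z; first by apply: nz; exists c.
by apply.
Qed.

End Chevalley.

(** * Coordinates with [eta^2 = xi F(xi)] *)

Lemma poly_split0 (R : nzRingType) (A : {poly R}) :
  exists A1, A = A.[0]%:P + 'X * A1.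
Proof.
have /factor_theorem[A1 E] : root (A - A.[0]%:P) 0.
  by rewrite /root hornerD hornerN hornerC subrr.
by exists A1; rewrite -commr_polyX -[X in A1 * X]subr0 -E addrC subrK.
Qed.

Section PlaceUnits.
Context (k K : fieldType) (iota : {rmorphism k -> K}) (P : place iota).

(** Here and below, [~ P t^-1] expresses that [t] lies in the maximal ideal of [P]. If
    [t / (c + t z)] is regular, so is [(c + t z)^-1 = c^-1 (1 - z t / (c + t z))]; otherwise
    [c / t + z] is regular, and so is [t^-1], a contradiction. *)
Lemma place_unit (c : k) t z : ~ P t^-1 -> P z -> c != 0 ->
  iota c + t * z != 0 /\ P (iota c + t * z)^-1.
Proof.
move=> nt Pz c0; have hP := place_ring P.
have ic0 : iota c != 0 by rewrite fmorph_eq0.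
have t0 : t != 0 by apply/eqP => t0; apply: nt; rewrite t0 invr0; exact: pl0.
have u0 : iota c + t * z != 0.
  apply/eqP => E; apply: nt.
  have -> : t^-1 = - (iota c^-1 * z).
    rewrite fmorphV; have -> : iota c = - (t * z) by apply/eqP; rewrite -addr_eq0 E.
    have tz0 : z != 0.
      by apply: contraNneq ic0 => z0; move: E; rewrite z0 mulr0 addr0 => ->.
    by field; rewrite oppr_eq0 mulf_neq0.
  by apply: (ringN hP); apply: (ringM hP) => //; exact: pl_const.
split=> //; case: (pl_val P (t / (iota c + t * z))) => [h|].
  have -> : (iota c + t * z)^-1 =
      iota c^-1 * (1 - z * (t / (iota c + t * z))).
    by rewrite fmorphV; field; rewrite ic0 u0.
  apply: (ringM hP); first exact: pl_const.
  apply: (ringB hP); last exact: (ringM hP).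
  exact: pl1.
rewrite invf_div mulrDl mulrAC mulfV // mul1r => h; exfalso; apply: nt.
have -> : t^-1 = iota c^-1 * ((iota c / t + z) - z).
  by rewrite fmorphV addrK; field; rewrite ic0 t0.
by apply: (ringM hP); [exact: pl_const|exact: (ringB hP)].
Qed.

Lemma place_sqr z : P (z ^+ 2) -> P z.
Proof.
move=> Pz2; case: (pl_val P z) => // Pz.
have [->|z0] := eqVneq z 0; first exact: pl0.
by have -> : z = z ^+ 2 * z^-1 by [field]; apply: pl_mul.
Qed.

End PlaceUnits.

Section Coordinates.
Context (k K : fieldType) (iota : {rmorphism k -> K}) (F : {poly k}).
Context (xi eta : K).
Hypothesis F0 : F.[0] != 0.
Hypothesis hK : is_function_field iota ('X * F) xi eta.
Local Notation ev A := (map_poly iota A).[xi].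
Implicit Types (A B C : {poly k}) (z : K).

Lemma evD A B : ev (A + B) = ev A + ev B. Proof. by rewrite rmorphD hornerD. Qed.
Lemma evB A B : ev (A - B) = ev A - ev B.
Proof. by rewrite rmorphB hornerD hornerN. Qed.
Lemma evM A B : ev (A * B) = ev A * ev B. Proof. by rewrite rmorphM hornerM. Qed.
Lemma evX : ev 'X = xi. Proof. by rewrite map_polyX hornerX. Qed.
Lemma evC c : ev c%:P = iota c. Proof. by rewrite map_polyC hornerC. Qed.
Lemma ev0 : ev (0 : {poly k}) = 0. Proof. by rewrite rmorph0 horner0. Qed.
Lemma ev1 : ev (1 : {poly k}) = 1. Proof. by rewrite rmorph1 hornerC. Qed.

Lemma ev_eq0 A : ev A = 0 -> A = 0. Proof. by case: hK => h _ _ /h. Qed.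

Lemma ev_neq0 A : A != 0 -> ev A != 0.
Proof. by apply: contra_neq => /ev_eq0. Qed.

Lemma eta_sqr : eta ^+ 2 = xi * ev F.
Proof. by case: hK => _ -> _; rewrite evM evX. Qed.

Lemma F_neq0 : F != 0.
Proof. by apply: contraNneq F0 => ->; rewrite horner0. Qed.

(** The order at 0 is even on the left and odd on the right. Concretely, [X] divides [A], then [B]
    because [F(0)] is nonzero, and both can be divided by [X]: a descent on the size of [A]. *)
Lemma XF_not_square A B : A ^+ 2 = B ^+ 2 * ('X * F) -> B = 0.
Proof.
have X0 : ('X : {poly k}) != 0 by rewrite polyX_eq0.
have [n] := ubnP (size A); elim: n A B => // n IH A B sA E.
have /eqP A00 : A.[0] == 0.
  have : (A ^+ 2).[0] == 0 by rewrite E !hornerM hornerX mul0r mulr0.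
  by rewrite horner_exp expf_eq0.
have [A1] := poly_split0 A; rewrite A00 add0r => EA; rewrite EA in sA E.
have [A10|A10] := eqVneq A1 0.
  move: E; rewrite A10 mulr0 expr0n /= => /esym/eqP.
  rewrite mulf_eq0 expf_eq0 /= => /orP[/eqP //|].
  by rewrite mulf_eq0 polyX_eq0 (negPf F_neq0).
have E1 : 'X * A1 ^+ 2 = B ^+ 2 * F.
  by apply: (mulfI X0); transitivity (('X * A1) ^+ 2); [ring|rewrite E; ring].
have /eqP B00 : B.[0] == 0.
  have : (B ^+ 2 * F).[0] = 0 by rewrite -E1 hornerM hornerX mul0r.
  by move/eqP; rewrite hornerM mulf_eq0 (negPf F0) orbF horner_exp expf_eq0.
have [B1] := poly_split0 B; rewrite B00 add0r => EB; rewrite EB in E1 *.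
rewrite (IH A1 B1) ?mulr0 //.
  by move: sA; rewrite mulrC size_mulX.
by apply: (mulfI X0); rewrite E1; ring.
Qed.

Lemma coord_free A B : ev A + ev B * eta = 0 -> A = 0 /\ B = 0.
Proof.
move=> E; have B0 : B = 0.
  apply: (@XF_not_square A B); apply/eqP; rewrite -subr_eq0; apply/eqP/ev_eq0.
  rewrite evB ![in ev (_ ^+ 2)]expr2 !evM evX -eta_sqr.
  by rewrite (_ : ev A = - (ev B * eta)); [ring|apply/eqP; rewrite -addr_eq0 E].
by move: E; rewrite B0 ev0 mul0r addr0 => /ev_eq0.
Qed.

Lemma coord_ex z : exists A B C, C != 0 /\ ev C * z = ev A + ev B * eta.
Proof.
pose S := [pred z | `[< exists A B C, C != 0 /\ ev C * z = ev A + ev B * eta >]].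
have [_ _ gen] := hK; suff /gen/(_ _ _ _ z)/asboolP : divring_closed S.
  apply=> [c||]; apply/asboolP.
  - by exists c%:P, 0, 1; rewrite oner_eq0 ev0 ev1 evC; split=> //; ring.
  - by exists 'X, 0, 1; rewrite oner_eq0 ev0 ev1 evX; split=> //; ring.
  - by exists 0, 1, 1; rewrite oner_eq0 ev0 ev1; split=> //; ring.
split=> [|u v /asboolP[A [B [C [C0 E]]]] /asboolP[A' [B' [C' [C'0 E']]]]
  |u v /asboolP[A [B [C [C0 E]]]] /asboolP[A' [B' [C' [C'0 E']]]]]; apply/asboolP.
- by exists 1, 0, 1; rewrite oner_eq0 ev0 ev1; split=> //; ring.
- exists (C' * A - C * A'), (C' * B - C * B'), (C * C'); split; first by rewrite mulf_neq0.
  by rewrite !evB !evM; ring: E E'.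
have [->|v0] := eqVneq v 0.
  by exists 0, 0, 1; rewrite oner_eq0 ev0 ev1 invr0; split=> //; ring.
(* The quotient is expanded by the conjugate [A' - B' eta]. The norm appearing in the denominator is
   nonzero by [XF_not_square], since [v] is. *)
exists (C' * (A * A' - B * B' * ('X * F))), (C' * (B * A' - A * B')),
  (C * (A' ^+ 2 - B' ^+ 2 * ('X * F))); split.
  rewrite mulf_neq0 // subr_eq0; apply/eqP => N.
  have B0 := XF_not_square N; move: N; rewrite B0 expr0n /= mul0r => /eqP.
  rewrite expf_eq0 /= => /eqP A0; move/eqP: E'; rewrite A0 B0 ev0 mul0r addr0.
  by rewrite mulf_eq0 (negPf v0) (negPf (ev_neq0 C'0)).
rewrite !expr2 !(evM, evB, evX) -eta_sqr.
have -> : ev C * (ev A' * ev A' - ev B' * ev B' * eta ^+ 2) * (u / v)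
  = (ev C * u) * (ev A' - ev B' * eta) * (ev A' + ev B' * eta) / v by ring.
by rewrite E -E'; field.
Qed.

Section Center.
Context (P : place iota).
Hypothesis Pxi : ~ P xi^-1.
Let hP := place_ring P.

Lemma center_xi : P xi. Proof. by case: (pl_val P xi). Qed.

Lemma center_ev A : P (ev A). Proof. exact/(ring_horner_map hP)/center_xi. Qed.

Lemma center_unit A : A.[0] != 0 -> P (ev A)^-1.
Proof.
move=> A0; have [A1 ->] := poly_split0 A; rewrite evD evM evC evX.
by have [] := place_unit Pxi (center_ev A1) A0.
Qed.

Lemma xiE : xi = eta ^+ 2 * (ev F)^-1.
Proof. by rewrite eta_sqr mulfK // ev_neq0 // F_neq0. Qed.

Lemma center_eta : P eta.
Proof.
by apply: place_sqr; rewrite eta_sqr; apply: pl_mul; [exact: center_xi|exact: center_ev].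
Qed.

Lemma center_etaV : ~ P eta^-1.
Proof.
move=> h; apply: Pxi; rewrite xiE invf_div expr2.
have -> : ev F / (eta * eta) = ev F * eta^-1 * eta^-1 by rewrite invfM mulrA.
by do 2![apply: pl_mul => //]; exact: center_ev.
Qed.

Lemma eta_neq0 : eta != 0.
Proof. by apply/eqP => E; apply: center_etaV; rewrite E invr0; apply: pl0. Qed.

Lemma xi_neq0 : xi != 0.
Proof. by apply/eqP => E; apply: Pxi; rewrite E invr0; apply: pl0. Qed.

(** A polynomial in [xi] with nonzero constant term is a unit at [P], while [eta] lies in the
    maximal ideal. *)
Lemma center_eta_unit A w : P w -> ev A = eta * w -> A.[0] = 0.
Proof.
move=> Pw E; apply/eqP; apply/negPn/negP => A0; apply: center_etaV.
have An0 : ev A != 0.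
  by apply: ev_neq0; apply: contraNneq A0 => ->; rewrite horner0.
have w0 : w != 0 by apply: contraNneq An0 => w0; rewrite E w0 mulr0.
have -> : eta^-1 = w * (ev A)^-1 by rewrite E; field; rewrite w0 eta_neq0.
by apply: pl_mul => //; exact: center_unit.
Qed.

(* Descent: as long as [C] vanishes at [0], so do [A] and [B]. *)
Lemma center_coord z : P z ->
  exists A B C, C.[0] != 0 /\ ev C * z = ev A + ev B * eta.
Proof.
move=> Pz; have [A [B [C [C0 E]]]] := coord_ex z.
have [n] := ubnP (size C); elim: n A B C C0 E => // n IH A B C C0 E sC.
have [C00|C00] := eqVneq C.[0] 0; last by exists A, B, C.
have [C1 EC] := poly_split0 C; rewrite C00 add0r in EC.
rewrite EC evM evX in E; rewrite EC in sC C0.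
have C10 : C1 != 0 by apply: contraNneq C0 => ->; rewrite mulr0.
have A00 : A.[0] = 0.
  apply: (@center_eta_unit _ (eta * (ev F)^-1 * ev C1 * z - ev B)).
    apply: pl_sub; last exact: center_ev.
    do 2![apply: pl_mul => //]; last exact: center_ev.
    by apply: pl_mul; [exact: center_eta|exact: center_unit].
  have -> : ev A = xi * ev C1 * z - ev B * eta by rewrite E addrK.
  by rewrite {1}xiE; ring.
have [A1 EA] := poly_split0 A; rewrite A00 add0r in EA.
rewrite EA evM evX in E.
have E1 : ev B * ev F = eta * (ev C1 * z - ev A1).
  apply: (mulfI xi_neq0); transitivity (eta * (xi * ev C1 * z - xi * ev A1)); last by ring.
  rewrite E addrAC subrr add0r.
  by transitivity (ev B * eta ^+ 2); [rewrite eta_sqr|]; ring.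
have B00 : B.[0] = 0.
  have /eqP : (B * F).[0] = 0.
    apply: (@center_eta_unit _ (ev C1 * z - ev A1)); last by rewrite evM.
    by apply: pl_sub; [apply: pl_mul => //|]; exact: center_ev.
  by rewrite hornerM mulf_eq0 (negPf F0) orbF => /eqP.
have [B1 EB] := poly_split0 B; rewrite B00 add0r in EB.
rewrite EB evM evX in E.
apply: (IH A1 B1 C1) => //; last first.
  by move: sC; rewrite mulrC size_mulX.
by apply: (mulfI xi_neq0); rewrite mulrA E; ring.
Qed.

End Center.

(** By [center_coord], the local ring consists of the fractions [(A + B eta) / C] with [C(0)]
    nonzero, a description in which the place does not occur. *)
Lemma center_unique (P Q : place iota) : ~ P xi^-1 -> ~ Q xi^-1 -> P = Q.
Proof.
suff sub (P' Q' : place iota) : ~ P' xi^-1 -> ~ Q' xi^-1 -> forall z, P' z -> Q' z.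
  by move=> hP hQ; apply: place_eq => z; split; apply: sub.
move=> hP hQ z /(center_coord hP)[A [B [C [C0 E]]]].
have -> : z = (ev C)^-1 * (ev A + ev B * eta).
  by rewrite -E mulKf // ev_neq0 //; apply: contraNneq C0 => ->; rewrite horner0.
apply: pl_mul; first exact: center_unit.
apply: pl_add; [|apply: pl_mul]; try exact: center_ev.
exact: center_eta.
Qed.

(* The value at [A(xi) + B(xi) eta] of the derivation with [xi |-> 2 eta], hence
   [eta |-> (X F)'(xi)] because [eta^2 = xi F(xi)]. *)
Definition coord_der A B : K :=
  ev A^`() * (2%:R * eta) + ev B^`() * (2%:R * eta ^+ 2) + ev B * (ev ('X * F)^`()).

Lemma coord_derM C A B : coord_der (C * A) (C * B) =
  ev C * coord_der A B + ev C^`() * (2%:R * eta) * (ev A + ev B * eta).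
Proof. by rewrite /coord_der (derivM C A) (derivM C B) !(evM, evD); ring. Qed.

Lemma coord_derD A B A' B' :
  coord_der (A + A') (B + B') = coord_der A B + coord_der A' B'.
Proof. by rewrite /coord_der !derivD !evD; ring. Qed.

Lemma coord_der_prod A B A' B' :
  coord_der (A * A' + B * B' * ('X * F)) (A * B' + B * A') =
  (ev A + ev B * eta) * coord_der A' B' + (ev A' + ev B' * eta) * coord_der A B.
Proof.
rewrite /coord_der !derivD (derivM A A') (derivM (B * B')) (derivM B B').
rewrite (derivM A B') (derivM B A') !(evM, evD) evX -eta_sqr.
by ring: eta_sqr.
Qed.

(** Through the universal property of [Omega], this derivation turns differentials into functions.
    It is used because it preserves the local ring at the zero of [xi] and sends [eta] to a unit
    there. The formula is the quotient rule. *)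
Lemma derivation_ex : exists2 D : K -> K, derivation iota (D : K -> K^o) &
  forall A B C z, C != 0 -> ev C * z = ev A + ev B * eta ->
    ev C * D z = coord_der A B - z * ev C^`() * (2%:R * eta).
Proof.
have ex z : exists e, forall A B C, C != 0 -> ev C * z = ev A + ev B * eta ->
    ev C * e = coord_der A B - z * ev C^`() * (2%:R * eta).
  have [A [B [C [C0 E]]]] := coord_ex z.
  (* Independence of the presentation: two presentations of [z], once cross-multiplied, have equal
     coordinates by [coord_free]. *)
  exists ((coord_der A B - z * ev C^`() * (2%:R * eta)) / ev C) => A' B' C' C'0 E'.
  have [] := @coord_free (C * A' - C' * A) (C * B' - C' * B).
    rewrite !evB !evM.
    transitivity (ev C * (ev A' + ev B' * eta) - ev C' * (ev A + ev B * eta)).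
      by ring.
    by rewrite -E -E'; ring.
  move=> /subr0_eq EA /subr0_eq EB.
  have H := coord_derM C A' B'; rewrite EA EB coord_derM -E -E' in H.
  apply: (mulfI (ev_neq0 C0)); rewrite mulrCA [ev C * (_ / _)]mulrC divfK ?ev_neq0 //.
  rewrite !mulrBr.
  have -> : ev C * coord_der A' B' =
      ev C' * coord_der A B + ev C'^`() * (2%:R * eta) * (ev C * z) -
      ev C^`() * (2%:R * eta) * (ev C' * z) by rewrite H addrK.
  by ring.
pose D z := projT1 (cid (ex z)).
have DE A B C z : C != 0 -> ev C * z = ev A + ev B * eta ->
    ev C * D z = coord_der A B - z * ev C^`() * (2%:R * eta).
  by rewrite /D; case: cid => e /=; apply.
exists D => //; split=> [a b|a b|c].
- have [A [B [C [C0 E]]]] := coord_ex a; have [A' [B' [C' [C'0 E']]]] := coord_ex b.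
  have CC0 : C * C' != 0 by rewrite mulf_neq0.
  apply: (mulfI (ev_neq0 CC0)).
  rewrite (DE (C' * A + C * A') (C' * B + C * B')) //; last first.
    by rewrite !(evM, evD); ring: E E'.
  rewrite coord_derD !coord_derM -E -E' derivM !(evM, evD).
  have := DE _ _ _ _ C0 E; have := DE _ _ _ _ C'0 E' => H' H.
  transitivity (ev C' * (ev C * D a) + ev C * (ev C' * D b)); last by ring.
  by rewrite H H'; ring.
- have [A [B [C [C0 E]]]] := coord_ex a; have [A' [B' [C' [C'0 E']]]] := coord_ex b.
  have CC0 : C * C' != 0 by rewrite mulf_neq0.
  apply: (mulfI (ev_neq0 CC0)).
  rewrite (DE (A * A' + B * B' * ('X * F)) (A * B' + B * A')) //; last first.
    rewrite !(evM, evD) evX -eta_sqr.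
    transitivity ((ev C * a) * (ev C' * b)); first by ring.
    by rewrite E E'; ring.
  rewrite coord_der_prod -E -E' derivM !(evM, evD).
  have := DE _ _ _ _ C0 E; have := DE _ _ _ _ C'0 E' => H' H.
  transitivity (ev C * a * (ev C' * D b) + ev C' * b * (ev C * D a)); last first.
    by rewrite -![_ *: _]/(_ * _); ring.
  by rewrite H H'; ring.
- have := @DE c%:P 0 1 (iota c) (oner_neq0 _).
  rewrite ev1 evC ev0 mul1r mul0r addr0 mul1r => ->  //.
  by rewrite /coord_der derivC deriv0 (derivC (1 : k)) !ev0; ring.
Qed.

End Coordinates.

(** * The local obstruction *)

Section LocalObstruction.
Context (k K : fieldType) (iota : {rmorphism k -> K}) (F : {poly k}).
Context (xi eta : K) (P : place iota) (tau : kaut iota) (n : nat).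
Hypothesis F0 : F.[0] != 0.
Hypothesis hK : is_function_field iota ('X * F) xi eta.
Hypothesis Pxi : ~ P xi^-1.
Hypothesis tau_xi : tau xi = xi / (1 + xi).
Hypothesis tau_eta : tau eta = eta / (1 + xi) ^+ n.+1.
Local Notation ev A := (map_poly iota A).[xi].
Let hP := place_ring P.
Let u := (1 + xi)^-1.

Lemma unit_1Dxi : 1 + xi != 0 /\ P u.
Proof.
have := place_unit Pxi (pl1 P) (oner_neq0 k).
by rewrite rmorph1 mulr1.
Qed.

Lemma u_powE m : exists2 w, P w & u ^+ m = 1 + xi * (- m%:R + xi * w).
Proof.
have [u0 Pu] := unit_1Dxi.
elim: m => [|m [w Pw IH]]; first by exists 0; [exact: pl0|rewrite expr0; ring].
exists (u + m%:R * u + w * u).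
  apply: pl_add; last exact: pl_mul.
  apply: pl_add => //; apply: pl_mul => //; rewrite -(rmorph_nat iota).
  exact: pl_const.
by rewrite exprSr IH -natr1 /u; field.
Qed.

(** Regularity of [z] is included so that these functions form a ring: congruences modulo [eta^2]
    multiply only between regular functions. *)
Definition tau_close z := P z /\ exists2 r, P r & tau z = z + eta ^+ 2 * r.

Lemma tau_close_ring : intermediate_ring iota tau_close.
Proof.
have Peta := center_eta hK Pxi.
split=> [c|a b [Pa [r Pr Er]] [Pb [s Ps Es]]|a b [Pa [r Pr Er]] [Pb [s Ps Es]]].
- split; first exact: pl_const.
  by exists 0; [exact: pl0|rewrite kaut_const mulr0 addr0].
- split; first exact: pl_sub.
  exists (r - s); first exact: pl_sub.
  by rewrite rmorphB Er Es; ring.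
- split; first exact: pl_mul.
  exists (a * s + b * r + eta ^+ 2 * (r * s)).
    apply: pl_add; first by apply: pl_add; exact: pl_mul.
    by apply: pl_mul; [exact: (ringX hP)|exact: pl_mul].
  by rewrite rmorphM Er Es; ring.
Qed.

Lemma tau_close_inv z : tau_close z -> P z^-1 -> tau_close z^-1.
Proof.
move=> [Pz [r Pr Er]] Pz'; split=> //.
have [->|z0] := eqVneq z 0.
  by exists 0; [exact: pl0|rewrite invr0 rmorph0 mulr0 addr0].
have Peta := center_eta hK Pxi.
have Pw : P (eta * (r * z^-1)) by do 2![apply: pl_mul => //].
have [] := place_unit (center_etaV F0 hK Pxi) Pw (oner_neq0 k).
rewrite rmorph1; set t := 1 + _ => t0 Pt.
have tE : z + eta ^+ 2 * r = z * t by rewrite /t; field.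
exists (- (r * z^-1 * z^-1 * t^-1)).
  by apply: (ringN hP); do 3![apply: pl_mul => //].
rewrite fmorphV Er tE.
have -> : (z * t)^-1 = z^-1 - (t - 1) * z^-1 * t^-1 by field; rewrite z0 t0.
by congr (_ + _); rewrite {1}/t; field; rewrite z0 t0.
Qed.

Lemma tau_close_xi : tau_close xi.
Proof.
split; first exact: center_xi.
have [u0 Pu] := unit_1Dxi; exists (- ((ev F)^-1 * xi * u)).
  apply: (ringN hP); apply: pl_mul => //; apply: pl_mul; last exact: center_xi.
  exact: center_unit.
rewrite tau_xi -/u; transitivity (xi - xi * (xi * u)).
  by rewrite /u; field.
by rewrite {2}(xiE F0 hK); ring.
Qed.

Lemma tau_close_eta : tau_close eta.
Proof.
split; first exact: (center_eta hK).
have [w Pw uE] := u_powE n.+1.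
exists (eta * (ev F)^-1 * (- n.+1%:R + xi * w)).
  apply: pl_mul.
    by apply: pl_mul; [exact: (center_eta hK)|exact: center_unit].
  apply: pl_add; last by apply: pl_mul => //; exact: center_xi.
  by apply: (ringN hP); rewrite -(rmorph_nat iota); exact: pl_const.
rewrite tau_eta -exprVn -/u uE mulrDr mulr1; congr (_ + _).
by rewrite {1}(xiE F0 hK); ring.
Qed.

(** Every regular function is a fraction in [xi] and [eta] with unit denominator, so closure under
    the ring operations and inverses of units reduces the claim to [xi] and [eta]. *)
Lemma tau_closeP z : P z -> tau_close z.
Proof.
move=> /(center_coord F0 hK Pxi)[A [B [C [C0 E]]]].
have hT := tau_close_ring.
have C0' : ev C != 0.
  by apply: (ev_neq0 hK); apply: contraNneq C0 => ->; rewrite horner0.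
have -> : z = (ev C)^-1 * (ev A + ev B * eta) by rewrite -E mulKf.
have T A' : tau_close (ev A') by apply: (ring_horner_map hT); exact: tau_close_xi.
apply: (ringM hT).
  by apply: tau_close_inv; [exact: T|exact: center_unit].
by apply: (ringD hT) => //; apply: (ringM hT) => //; exact: tau_close_eta.
Qed.

(** [tau] multiplies [eta / xi] by [(1 + xi)^-n], whose expansion begins with [1 - n xi]. *)
Lemma tau_diffE : exists2 w, P w &
  tau (eta / xi) - eta / xi = eta * (- n%:R + xi * w).
Proof.
have [w Pw uE] := u_powE n; exists w => //.
have [u0 _] := unit_1Dxi; have x0 := xi_neq0 Pxi.
rewrite rmorphM fmorphV tau_xi tau_eta.
have -> : eta / (1 + xi) ^+ n.+1 / (xi / (1 + xi)) = eta / xi * u ^+ n.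
  by rewrite /u exprVn exprS; field; rewrite x0 u0 expf_neq0.
by rewrite uE; field.
Qed.

Lemma tau_diff_regular : P (tau (eta / xi) - eta / xi).
Proof.
have [w Pw ->] := tau_diffE.
apply: pl_mul; first exact: (center_eta hK).
apply: pl_add; last by apply: pl_mul => //; exact: center_xi.
by apply: (ringN hP); rewrite -(rmorph_nat iota); exact: pl_const.
Qed.

Context (Omega : kaehler iota).
Hypothesis n0 : n%:R != 0 :> k.

(** Both sides are compared under the linear map [phi] induced by [D]: the left side becomes a
    multiple of [eta], the right side is [-n D(eta)] up to such multiples, and [D(eta)] has value
    [F(0)] at [P]. *)
Lemma regular_diff_tau w : Omega_X Omega P w ->
  diff_pull tau w - w <> diff Omega (tau (eta / xi) - eta / xi) :> Omega.
Proof.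
have [D derD DE] := derivation_ex F0 hK.
have [DD DM Dc] := derD.
have Peta := center_eta hK Pxi.
have Pxi' := center_xi Pxi.
have Pnat m : P m%:R by rewrite -(rmorph_nat iota); exact: pl_const.
have Pev A : P (ev A) by exact: center_ev.
have PD z : P z -> P (D z).
  move=> Pz; have [A [B [C [C0 E]]]] := center_coord F0 hK Pxi Pz.
  have Cp0 : C != 0 by apply: contraNneq C0 => ->; rewrite horner0.
  have -> : D z = (ev C)^-1 *
      (coord_der iota F xi eta A B - z * ev C^`() * (2%:R * eta)).
    by rewrite -(DE A B C z) // mulKf // (ev_neq0 hK).
  apply: pl_mul; first exact: center_unit.
  rewrite /coord_der; do ![apply: pl_sub => //|apply: pl_add => //
    |apply: pl_mul => //|apply: (ringX hP) => //].
have Deta : D eta = ev ('X * F)^`().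
  have := DE 0 1 1 eta (oner_neq0 _); rewrite (ev1 iota xi) (ev0 iota xi) mul1r add0r mul1r.
  move=> ->//; rewrite /coord_der deriv0 (derivC (1 : k)) (ev0 iota xi) (ev1 iota xi).
  by ring.
have Dmul a b : D (a * b) = a * D b + b * D a by exact: DM.
have Dsq r : D (eta ^+ 2 * r) = eta * (eta * D r + r * (2%:R * D eta)).
  by rewrite Dmul expr2 Dmul; ring.
have [phi phid] := kaehler_ex Omega derD.
move=> [s Ps ->] E.
(* In each summand [a db], [tau] changes [a] and [b] by multiples of [eta^2], and [D(eta^2 r)] is
   still a multiple of [eta]. *)
have [r1 Pr1 E1] : exists2 r, P r &
    phi (\sum_(p <- s) tau p.1 *: diff Omega (tau p.2)) -
    phi (\sum_(p <- s) p.1 *: diff Omega p.2) = eta * r.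
  elim: s Ps {E} => [|[a b] s IH] Ps.
    by exists 0; [exact: pl0|rewrite !big_nil mulr0 subrr].
  have [|r Pr Er] := IH; first by move=> p ps; apply: Ps; rewrite inE ps orbT.
  have [Pa Pb] : P a /\ P b by apply: (Ps (a, b)); rewrite inE eqxx.
  have [_ [ra Pra Era]] := tau_closeP Pa; have [_ [rb Prb Erb]] := tau_closeP Pb.
  rewrite !big_cons !(linearD phi) opprD addrACA Er !(linearZ_LR phi) /=.
  rewrite !phid Era Erb DD Dsq -![_ *: _]/(_ * _).
  exists ((a + eta ^+ 2 * ra) * (eta * D rb + rb * (2%:R * D eta)) +
      eta * ra * D b + r).
    have PDb := PD _ Pb; have PDe := PD _ Peta; have PDr := PD _ Prb.
    by do ![apply: pl_add => //|apply: pl_mul => //|apply: (ringX hP) => //].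
  by ring.
have {}E1 : phi (diff Omega (tau (eta / xi) - eta / xi)) = eta * r1.
  by rewrite -E -E1 -diff_pull_sum; exact: (linearB phi).
rewrite phid in E1.
have [w' Pw' Ew'] := tau_diffE; rewrite Ew' in E1.
(* The polynomial [-n (X F)'] evaluates at [xi] to [-n D(eta)], which is [eta] times the regular
   function [w1]; so it vanishes at 0, where its value is [-n F(0)]. *)
have F0' : (- n%:R *: ('X * F)^`()).[0] = 0.
  pose w1 := r1 - (eta * (ev F)^-1 * w' * D eta + D (xi * w')).
  apply: (center_eta_unit F0 hK Pxi (w := w1)); rewrite /w1.
    apply: pl_sub => //; apply: pl_add; last by apply/PD/pl_mul.
    by do 3?[apply: pl_mul => //]; [exact: center_unit|exact: PD].
  rewrite map_polyZ hornerZ -Deta rmorphN rmorph_nat mulrBr -E1.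
  have Dn : D (- n%:R) = 0.
    by rewrite -(rmorph_nat iota) -rmorphN Dc.
  rewrite Dmul DD Dn.
  transitivity (- n%:R * D eta + (xi - eta ^+ 2 * (ev F)^-1) * w' * D eta).
    by rewrite -(xiE F0 hK); ring.
  by ring.
move/eqP: F0'; rewrite hornerZ derivM derivX mul1r hornerD hornerM hornerX mul0r addr0.
by rewrite mulf_eq0 oppr_eq0 (negPf n0) (negPf F0).
Qed.

End LocalObstruction.

(** * Function fields and the class of [y / x^g] *)

Lemma subval_sub (R : nzRingType) (V : lmodType R) (Z : submod V) (u v : sub Z) :
  sub_val (u - v) = sub_val u - sub_val v.
Proof. exact: (raddfB (\val : {linear sub Z -> V})). Qed.

Lemma finite_subsingleton (T : Type) (A : set T) :
  (forall a b, A a -> A b -> a = b) -> finite_set A.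
Proof.
move=> Aeq; have [[a Aa]|nA] := pselect (exists a, A a).
  by apply: (sub_finite_set (B := [set a])) => // b Ab; exact: Aeq.
by apply: (sub_finite_set (B := set0)) => // a Aa; apply: nA; exists a.
Qed.

Section FunctionFields.
Context (k : closedFieldType) (K : fieldType) (iota : {rmorphism k -> K}).
Implicit Types (f : {poly k}) (x y : K).

Lemma function_field_transcendental f x y :
  is_function_field iota f x y -> forall c, x <> iota c.
Proof.
move=> [tr _ _] c xc; have /eqP : 'X - c%:P = 0 :> {poly k}.
  apply: tr; rewrite rmorphB /= map_polyX map_polyC hornerD hornerN hornerX.
  by rewrite hornerC xc subrr.
by rewrite polyXsubC_eq0.
Qed.

Lemma divring_closedX (S : {pred K}) (a : K) n :
  divring_closed S -> a \in S -> a ^+ n \in S.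
Proof.
move=> [S1 _ SV] Sa; elim: n => [|n IH]; first by rewrite expr0.
have -> : a ^+ n.+1 = a / (1 / a ^+ n) by rewrite div1r invrK exprS.
by apply: (SV) => //; exact: SV.
Qed.

Lemma function_field_translate f x y (a : k) : is_function_field iota f x y ->
  is_function_field iota (f \Po ('X + a%:P)) (x - iota a) y.
Proof.
move=> [tr E gen]; have comp A : (map_poly iota (A \Po ('X + a%:P))).[x - iota a]
    = (map_poly iota A).[x].
  rewrite map_comp_poly horner_comp rmorphD /= map_polyX map_polyC /=.
  by rewrite hornerD hornerX hornerC subrK.
split=> [A EA||S Sd Sc Sx Sy]; last 1 first.
- apply: gen => //; have [_ SB _] := Sd.
  rewrite (_ : x = (x - iota a) - (iota (- a))); first exact: SB.
  by rewrite rmorphN opprK subrK.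
- have : A \Po ('X - a%:P) = 0.
    apply: tr; rewrite -comp -comp_polyA comp_polyB comp_polyX.
    by rewrite comp_polyC addrK comp_polyXr.
  move=> /(congr1 (fun B => B \Po ('X + a%:P))).
  by rewrite comp_poly0 -comp_polyA comp_polyB comp_polyX comp_polyC addrK comp_polyXr.
- by rewrite comp.
Qed.

(** [F] is [f] with its coefficients reversed, so [F(0)] is the leading coefficient. As the degree
    [2g + 1] is odd, dividing [y^2 = f(x)] by [x^(2g+2)] leaves one factor [x^-1]: infinity is a
    branch point and the results on the place [xi = 0] apply to it. *)
Lemma function_field_infinity f x y g : size f = (2 * g).+2 ->
    is_function_field iota f x y ->
  exists2 F : {poly k}, F.[0] != 0 &
    is_function_field iota ('X * F) x^-1 (y / x ^+ g.+1).
Proof.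
move=> sf hK; have [tr E gen] := hK.
have ntr := function_field_transcendental hK.
have x0 : x != 0 by apply/eqP => x0; apply: (ntr 0); rewrite rmorph0.
pose F := \poly_(j < (2 * g).+2) f`_((2 * g).+1 - j).
exists F.
  have : lead_coef f != 0 by rewrite lead_coef_eq0 -size_poly_eq0 sf.
  by rewrite lead_coefE sf horner_coef0 coef_poly subn0.
split=> [A EA||S Sd Sc Sxi Seta].
- apply: contrapT => /eqP A0; have [c xc] := algebraic_is_const A0 EA.
  by apply: (ntr c^-1); rewrite fmorphV -xc invrK.
- rewrite rmorphM hornerM /= map_polyX hornerX exprMn E exprVn -exprM.
  rewrite (horner_coef_wide (n := (2 * g).+2)); last by rewrite size_map_poly sf.
  rewrite (horner_coef_wide (n := (2 * g).+2)); last first.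
    by rewrite size_map_poly size_poly.
  rewrite mulr_suml mulr_sumr (reindex_inj rev_ord_inj) /=.
  apply: eq_bigr => i _; rewrite !coef_map coef_poly ltn_ord subSS.
  have ii : (i <= (2 * g).+1)%N by rewrite -ltnS.
  rewrite [RHS]mulrCA -mulrA; congr (_ * _).
  rewrite -exprS; apply: (mulIf (expf_neq0 (g.+1 * 2) x0)); rewrite divfK ?expf_neq0 //.
  rewrite (_ : (g.+1 * 2)%N = (i.+1 + ((2 * g).+1 - i))%N); last by lia.
  by rewrite exprD mulrA -exprMn mulVf // expr1n mul1r.
- apply: gen => //.
    have [S1 _ SV] := Sd; rewrite -[x]invrK -div1r; exact: SV.
  have [S1 _ SV] := Sd.
  have -> : y = (y / x ^+ g.+1) / (x^-1 ^+ g.+1).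
    by rewrite exprVn invrK divfK // expf_neq0.
  by apply: SV => //; exact: divring_closedX.
Qed.

End FunctionFields.

Section NonSplitting.
Context (k : closedFieldType) (K : fieldType) (iota : {rmorphism k -> K}).
Context (F : {poly k}) (x y : K) (g : nat).
Hypothesis F0 : F.[0] != 0.
Hypothesis sF : size ('X * F) = (2 * g).+2.
Hypothesis g0 : g%:R != 0 :> k.
Hypothesis hK : is_function_field iota ('X * F) x y.
Context (Omega : kaehler iota) (tau : kaut iota).
Hypothesis tau_x : tau x = x + 1.
Hypothesis tau_y : tau y = y.

Let phi := y / x ^+ g.
Let x_neq0 : x != 0.
Proof.
by apply/eqP => x0; apply: (function_field_transcendental hK (c := 0)); rewrite rmorph0.
Qed.

Lemma y_regular (P : place iota) : P x -> P y.
Proof.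
move=> Px; apply: place_sqr; case: hK => _ -> _.
exact: (ring_horner_map (place_ring P)).
Qed.

Lemma phi_regular (P : place iota) : P x -> P x^-1 -> P phi.
Proof.
move=> Px PxV; apply: pl_mul; first exact: y_regular.
by rewrite -exprVn; exact: (ringX (place_ring P)).
Qed.

Lemma finite_infinity : finite_set [set P : place iota | ~ P x].
Proof.
have [F1 F10 hK1] := function_field_infinity sF hK.
apply: finite_subsingleton => P Q /= hP hQ.
by apply: (center_unique F10 hK1); rewrite invrK.
Qed.

Lemma finite_zeros : finite_set [set P : place iota | ~ P x^-1].
Proof. by apply: finite_subsingleton => P Q /= hP hQ; apply: (center_unique F0 hK). Qed.

Lemma push_finite (P : place iota) : push tau P x <-> P x.
Proof.
rewrite /= tau_x; split=> h; last by apply: pl_add => //; exact: pl1.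
by rewrite -[x](addrK 1); apply: pl_sub => //; exact: pl1.
Qed.

(* Both kinds of open sets omit at most one place, as [x] is ramified over [0]
   and infinity. *)
Definition std_cover (P : place iota) : set (place iota) :=
  if `[< P x >] then [set Q | Q x] else [set Q | Q x^-1].

(** This is a cochain of rational functions only: [phi] has a pole at infinity. Its coboundary is
    nevertheless regular on the overlaps, where [x] and [x^-1] both are. *)
Definition std_cochain (P : place iota) : K :=
  if `[< P x >] then 0 else phi.

Lemma std_cover_is_cover : is_cover std_cover.
Proof.
move=> P; rewrite /std_cover; case: asboolP => Px; split=> //=.
- exact: finite_infinity.
- by case: (pl_val P x).
- exact: finite_zeros.
Qed.

Definition std_cocycle (P Q : place iota) : K :=
  std_cochain Q - std_cochain P.

Lemma std_cocycleP : Z1 (O_X (iota:=iota))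
  (std_cocycle : place iota -> place iota -> rat_fun iota).
Proof.
split; last first.
  by move=> P Q R; rewrite /std_cocycle addrC addrA subrK.
exists std_cover; first exact: std_cover_is_cover.
move=> P Q R [CP CQ] /=; move: CP CQ.
rewrite /std_cover /std_cocycle /std_cochain.
case: asboolP => Px; case: asboolP => Qx /= RP RQ.
- by rewrite subrr; exact: pl0.
- by rewrite subr0; exact: phi_regular.
- by rewrite sub0r; apply: (ringN (place_ring R)); exact: phi_regular.
- by rewrite subrr; exact: pl0.
Qed.

Lemma tau_xi : tau x^-1 = x^-1 / (1 + x^-1).
Proof.
have x1 : x + 1 != 0 by rewrite -tau_x fmorph_eq0.
by rewrite fmorphV tau_x; field; rewrite x_neq0 x1.
Qed.

Lemma tau_eta : tau (y / x ^+ g.+1) = (y / x ^+ g.+1) / (1 + x^-1) ^+ g.+1.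
Proof.
have x1 : x + 1 != 0 by rewrite -tau_x fmorph_eq0.
rewrite rmorphM fmorphV rmorphXn /= tau_x tau_y -mulrA -invfM -exprMn.
by congr (_ / _ ^+ _); field.
Qed.

Lemma phiE : phi = (y / x ^+ g.+1) / x^-1.
Proof. by rewrite /phi invrK exprS; field; rewrite x_neq0 expf_neq0. Qed.

Lemma phi_tau_regular (P : place iota) : ~ P x -> P (tau phi - phi).
Proof.
move=> Px; have [F1 F10 hK1] := function_field_infinity sF hK.
rewrite phiE; apply: (tau_diff_regular hK1) tau_xi tau_eta.
by rewrite invrK.
Qed.

(** The pulled-back cocycle minus the original is the coboundary of [h], which is 0 at finite places
    and [tau phi - phi] at infinity, hence regular. *)
Lemma std_class_invariant (z0 : sub (Z1 (O_X (iota:=iota)))) :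
  sub_val z0 = std_cocycle ->
  H1_pull (@fun_pullP k K iota tau) (quo_pi (B1 (O_X (iota:=iota))) z0) =
  quo_pi (B1 (O_X (iota:=iota))) z0.
Proof.
move=> z0E; rewrite /H1_pull /= quomapE; apply/quo_eqP.
pose h P := tau (std_cochain (push tau P)) - std_cochain P : K.
exists h; last first.
  move=> P Q; rewrite subval_sub /= z0E /h.
  transitivity (tau (std_cocycle (push tau P) (push tau Q)) - std_cocycle P Q : K) => //.
  rewrite /std_cocycle rmorphB; ring.
exists (fun P => std_cover P `&` (push tau @^-1` std_cover (push tau P))).
  apply: is_coverI; first exact: std_cover_is_cover.
  exact/is_cover_pull/std_cover_is_cover.
move=> P Q []; rewrite /h /std_cochain /std_cover (asbool_equiv_eq (push_finite P)).
case: asboolP => Px /=; first by rewrite rmorph0 subrr => _ _; exact: pl0.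
(* Away from infinity, [phi] and [tau phi] are separately regular, thanks to the intersection with
   the pulled-back cover; at infinity only their difference is. *)
move=> QV tQV; have [Qx|Qx] := pselect (Q x); last exact: phi_tau_regular.
apply: pl_sub; last exact: phi_regular.
by apply: (@phi_regular (push tau Q)) => //; apply/push_finite.
Qed.

Theorem Hodge_deRham_nonsplit : ~ splits (Hodge_deRham Omega) (generated_by tau).
Proof.
move=> [s [sG sK]].
pose z0 := mksub std_cocycleP; pose c := quo_pi (B1 (O_X (iota:=iota))) z0.
have tc : H1_pull (@fun_pullP k K iota tau) c = c by exact: std_class_invariant.
have := sG tau (gen_gen tau) c; have := sK c => /=; rewrite tc.
move: (s c) => /= sc proj_sc /esym tau_sc.
pose z := repr sc; have zE : quo_pi _ z = sc := quo_reprK sc.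
move: proj_sc tau_sc; rewrite -zE /HdR_proj /H1_dR_pull /= !quomapE.
(* [h] compares the function part of [z] with [std_cocycle], because [s] is a section; [h'] compares
   the pull-back of [z] with [z], because [s] is equivariant. *)
move=> /quo_eqP[h [Ch hC hreg] hE] /quo_eqP[h' [Ch' hC' hreg'] [hE1 hE2]].
have hP (P : place iota) : P (h P) by apply: hreg; case: (hC P).
have hP' (P : place iota) : P (h' P) by apply: hreg'; case: (hC' P).
have [_ [CW hCW WC] dW] := Defs.sub_mem z.
pose W P : Omega := (sub_val z).2 P; pose f P Q : K := (sub_val z).1 P Q.
have fE P Q : f P Q = std_cocycle P Q + ((h Q : K) - h P).
  have := hE P Q; rewrite subval_sub => /(canRL (subrK _)) E.
  by rewrite addrC; exact: E.
have fE' P Q : tau (f (push tau P) (push tau Q)) - f P Q = (h' Q : K) - h' P.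
  by have := hE1 P Q; rewrite subval_sub.
have WE P : (diff_pull tau (W (push tau P)) : Omega) - W P = diff Omega (h' P).
  by have := hE2 P; rewrite subval_sub.
have dfE P Q : diff Omega (f P Q) = W Q - W P by exact: dW.
have dB a b : diff Omega (a - b) = diff Omega a - diff Omega b.
  by have [dD _ _] := diffP Omega; apply/esym/eqP; rewrite subr_eq -dD subrK.
(* Subtracting the coboundary of [h] turns [z] into a cocycle with function part [std_cocycle] and
   differential part [om]. *)
pose om P : Omega := W P - diff Omega (h P).
have om_reg P : Omega_X Omega P (om P).
  have WP : Omega_X Omega P (W P) by apply: WC; case: (hCW P).
  have dhP : Omega_X Omega P (diff Omega (h P)).
    exists [:: (1, h P : K)]; last by rewrite big_seq1 scale1r.
    by move=> p; rewrite inE => /eqP ->; split; [exact: pl1|exact: hP].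
  by have := submodP (-1) dhP WP; rewrite scaleN1r addrC.
have [Pi Pix] := place_avoiding (function_field_transcendental hK).
have tPix : ~ push tau Pi x by move/push_finite.
have std_inf (P : place iota) : ~ P x -> std_cochain P = phi.
  by rewrite /std_cochain; case: asboolP.
(* Both places are poles of [x], so [std_cocycle] vanishes between them, and [om] takes the same
   value at both. *)
have om_tau : om (push tau Pi) = om Pi.
  have := dfE (push tau Pi) Pi; rewrite fE /std_cocycle !std_inf // subrr add0r dB.
  rewrite /om => E; apply/eqP; rewrite eq_sym subr_eq addrAC -addrA.
  by rewrite E addrC subrK.
pose theta := tau phi - phi.
(* [h0] is the value at [Pi] of an expression in a place [Q] that, by [fE] and [fE'], does not
   depend on [Q]. Since at each [Q] the expression is regular, [h0] is constant and [d h0 = 0]. *)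
pose h0 : K := (h' Pi : K) - (tau (h (push tau Pi)) - h Pi) - theta.
have h0_reg (Q : place iota) : Q h0.
  have -> : h0 = (h' Q : K) - (tau (h (push tau Q)) - h Q) -
      (tau (std_cochain (push tau Q)) - std_cochain Q).
    have -> : (h' Q : K) = h' Pi + (tau (f (push tau Pi) (push tau Q)) - f Pi Q).
      by rewrite fE' addrC subrK.
    rewrite !fE /std_cocycle !(std_inf Pi, std_inf (push tau Pi)) // /h0 /theta.
    by rewrite !(rmorphB, rmorphD) /=; ring.
  apply: pl_sub; first apply: pl_sub; first exact: hP'.
    by apply: pl_sub; [exact: (hP (push tau Q))|exact: hP].
  rewrite /std_cochain (asbool_equiv_eq (push_finite Q)).
  case: asboolP => Qx; first by rewrite rmorph0 subrr; exact: pl0.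
  exact: phi_tau_regular.
have [c0 h0c] := regular_everywhere_const h0_reg.
have [F1 F10 hK1] := function_field_infinity sF hK.
have Pixi : ~ Pi x^-1^-1 by rewrite invrK.
have := regular_diff_tau F10 hK1 Pixi tau_xi tau_eta g0 (om_reg Pi).
apply; rewrite -phiE -/theta -{1}om_tau.
have dh0 : diff Omega h0 = 0 by rewrite h0c; case: (diffP Omega).
have pullB v w :
    diff_pull tau (v - w : Omega) = diff_pull tau v - diff_pull tau w :> Omega.
  exact: (linearB (diff_pull (Omega := Omega) tau)).
rewrite /om pullB diff_pull_diff.
have -> : theta = (h' Pi : K) - (tau (h (push tau Pi)) - h Pi) - h0.
  by rewrite /h0; ring.
rewrite dB dh0 subr0 !dB -WE.
by rewrite !opprD !opprK addrACA.
Qed.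

End NonSplitting.


(** * Moving a root of [q(X^p - X)] to the origin *)

Section ArtinSchreierSubstitution.
Context (k : closedFieldType) (p : nat).

Lemma artin_schreier_root (b : k) : (1 < p)%N -> exists a : k, a ^+ p - a = b.
Proof.
move=> p_gt1; have p0 : (0 < p)%N by lia.
(* These coefficients encode the equation [a^p = b + a]. *)
have [a] := @solve_monicpoly k p (fun i => if i == 0 then b else (i == 1%N)%:R) p0.
have -> : p = (p - 2).+2 by lia.
rewrite !big_ord_recl big1 => [|i _]; last by rewrite /= mul0r.
by move=> E; exists a; rewrite E /= expr0 expr1; ring.
Qed.

Lemma size_artin_schreier : (1 < p)%N -> size ('X^p - 'X : {poly k}) = p.+1.
Proof.
by move=> p_gt1; rewrite size_polyDl size_polyXn // size_polyN size_polyX.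
Qed.

(** The polynomial [X^p - X] is additive, because Frobenius is. *)
Lemma artin_schreier_translate (a : k) : p \in [pchar k] ->
  ('X^p - 'X) \Po ('X + a%:P) = ('X^p - 'X) + (a ^+ p - a)%:P :> {poly k}.
Proof.
move=> hp; have hpX : p \in [pchar {poly k}] by rewrite pchar_poly.
rewrite comp_polyB comp_Xn_poly comp_polyX -(pFrobenius_autE hpX) rmorphD /=.
by rewrite !pFrobenius_autE polyCB rmorphXn /=; ring.
Qed.

Lemma simple_root_split (q : {poly k}) (b : k) : q != 0 -> root q b ->
  (mup b q <= 1)%N -> exists2 q1 : {poly k}, q1.[b] != 0 & q = q1 * ('X - b%:P).
Proof.
move=> q0 /factor_theorem[q1 E]; rewrite mup_leq // => ndiv; exists q1 => //.
apply: contraNneq ndiv => /eqP/factor_theorem[q2 E2].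
by rewrite E E2 -mulrA -expr2 dvdp_mull.
Qed.

End ArtinSchreierSubstitution.

Theorem mainTheorem1 (k : closedFieldType) (p : nat) (hp : p \in [pchar k])
  (p_ge3 : (3 <= p)%N) (q : {poly k}) (q_monic : q \is monic)
  (q_odd : odd (size q).-1) (q_roots : forall a : k, (mup a q <= 1)%N)
  (K : fieldType) (iota : {rmorphism k -> K}) (x y : K)
  (hX : is_function_field iota (q \Po ('X^p - 'X)) x y)
  (Omega : kaehler iota) (g : nat) (hg : has_dim (H0 (Omega_X Omega)) g)
  (g_ge2 : (2 <= g)%N) (tau : kaut iota) (tau_x : tau x = x + 1)
  (tau_y : tau y = y) :
  ~ splits (Hodge_deRham Omega) (generated_by tau).
Proof.
have p_odd : odd p.
  by case/even_prime: (pcharf_prime hp) => // E; rewrite E in p_ge3.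
have p_gt1 : (1 < p)%N by exact: ltnW.
have q0 : q != 0 by exact: monic_neq0.
have [b qb] : exists b, root q b.
  by apply/closed_rootP; apply: contraL q_odd => /eqP ->.
have [q1 q1b qE] := simple_root_split q0 qb (q_roots b).
(* With [a^p - a = b], the translate by [a] is [q(X^p - X + b)], and its factor
   [X^p - X = X (X^(p-1) - 1)] yields the required [X F]. Then [F(0) = -q1(b)], nonzero because [b]
   is a simple root. *)
have [a ab] := artin_schreier_root b p_gt1.
pose F : {poly k} := ('X^(p.-1) - 1) * (q1 \Po ('X^p - 'X + b%:P)).
have FE : (q \Po ('X^p - 'X)) \Po ('X + a%:P) = 'X * F.
  rewrite -comp_polyA artin_schreier_translate // ab {1}qE comp_polyM comp_polyB.
  rewrite comp_polyX comp_polyC addrK /F mulrC mulrA mulrBr mulr1 -exprS prednK //.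
  by lia.
have F0 : F.[0] != 0.
  rewrite hornerM hornerD hornerN hornerXn hornerC horner_comp !hornerD hornerN.
  rewrite !hornerXn hornerX !hornerC !expr0n !gtn_eqF /=; [|by lia|by lia].
  by rewrite !sub0r oppr0 add0r mulf_neq0 // oppr_eq0 oner_eq0.
pose n := ((size q).-1 * p)%N.
have n_odd : odd n by rewrite oddM q_odd.
have nE : n = (2 * n./2).+1 by have := odd_double_half n; rewrite n_odd; lia.
have sF : size ('X * F) = (2 * n./2).+2.
  rewrite -FE size_comp_poly2; last first.
    by rewrite size_polyDl size_polyX // size_polyC; case: (_ == _).
  have : (size (q \Po ('X^p - 'X))).-1 = (2 * n./2).+1.
    by rewrite size_comp_poly size_artin_schreier.
  by case: (size _) => // m /= ->.
(* As [p] divides [n = 2 n./2 + 1], the vanishing of [n./2] in [k] would give [1 = 0]. *)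
have g0 : (n./2)%:R != 0 :> k.
  apply/eqP => E; have : n%:R = 0 :> k by rewrite natrM (pcharf0 hp) mulr0.
  by rewrite nE -addn1 natrD natrM E mulr0 add0r => /eqP; rewrite oner_eq0.
have hX' := function_field_translate a hX; rewrite FE in hX'.
apply: (Hodge_deRham_nonsplit F0 sF g0 hX') => //.
by rewrite rmorphB kaut_const tau_x addrAC.
Qed.
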